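(* Let $a,b\in L^\infty$ satisfy the standing assumption on symbol pairs. (i) Either $\ker S_{a,b}=\{0\}$ or $\ker S_{b,a}=\{0\}$ (at least one of the two holds). (ii) If there exist $a',b'\in L^\infty$ such that $aa'+bb'=1$, then either $\ker S_{a,b}=\{0\}$ or $\ker S_{a,b}^*=\{0\}$ (at least one of the two holds).
   Context: $\mathbb T$ is the unit circle, $L^2=L^2(\mathbb T)$, $L^\infty=L^\infty(\mathbb T)$; $H^2_+=H^2(\mathbb D)$ is the Hardy space regarded as a closed subspace of $L^2$ via boundary values, $H^2_-=(H^2_+)^\perp$ in $L^2$, and $P^\pm$ are the orthogonal projections of $L^2$ onto $H^2_\pm$. For $a,b\in L^\infty$, $S_{a,b}f=aP^+f+bP^-f$ for $f\in L^2$, and $S_{a,b}^*$ is its Hilbert space adjoint. Standing assumption on a symbol pair $(a,b)$: $a\neq0$ a.e. and $b\neq 0$ a.e. on $\mathbb T$, and either $a=b$ or $a-b\neq0$ a.e. on $\mathbb T$. *)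

(* Defs.v *)
From HB Require Import structures.
From mathcomp Require Import all_boot all_order all_algebra.
From mathcomp Require Import all_classical all_reals all_analysis.
From mathcomp Require Import complex.

Set Implicit Arguments.
Unset Strict Implicit.
Unset Printing Implicit Defensive.

Import Order.TTheory GRing.Theory Num.Theory.
Import numFieldNormedType.Exports.

Local Open Scope classical_set_scope.
Local Open Scope ring_scope.

(* R[i] receives its topology through the regular-algebra alias R[i]^o. *)
Notation "C_[ R ]" := (R[i]^o) (at level 0, format "C_[ R ]").

Section LebesgueSpaces.
Context {R : realType}.

Lemma twopi_gt0 : 0 < 2 * pi :> R.
Proof. by rewrite mulr_gt0 ?pi_gt0. Qed.

(* The unit circle is parametrised by the angle, through expi on [0, 2 pi],
   and carries normalised arc length. A function on the circle is a function
   of the angle, and its values off [0, 2 pi] are irrelevant since arclength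
   does not charge them. *)
Definition circle_fun : Type := measurableTypeR R -> C_[R].

Definition expi (t : R) : C_[R] := (cos t +i* sin t)%C.

Definition arclength : probability (measurableTypeR R) R :=
  uniform_prob twopi_gt0.

Definition ae_eq_circle (f g : circle_fun) : Prop :=
  {ae arclength, forall t, f t = g t}.

(* Membership of a representative in L^p(T), for complex-valued functions;
   functions are identified through ae_eq_circle. *)
Definition Lp (p : \bar R) : set circle_fun :=
  [set f | [/\ measurable_fun [set: measurableTypeR R]
                 (fun t => complex.Re (f t) : R),
               measurable_fun [set: measurableTypeR R]
                 (fun t => complex.Im (f t) : R) &
               finite_norm arclength p (fun t => Normc.normc (f t))]].

Definition L2 := Lp 2%:E.
Definition Linfty := Lp +oo%E.

Definition cintegral (f : circle_fun) : C_[R] :=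
  (Rintegral arclength setT (fun t => complex.Re (f t)) +i*
   Rintegral arclength setT (fun t => complex.Im (f t)))%C.

Definition inner (f g : circle_fun) : C_[R] :=
  cintegral (fun t => f t * (g t)^*).

Definition L2perp (M : set circle_fun) : set circle_fun :=
  [set g | L2 g /\ forall h, M h -> inner g h = 0].

End LebesgueSpaces.

Arguments circle_fun : clear implicits.

Section HardySpaces.
Context {R : realType}.

(* Analytic functions on the open unit disc with square-summable Taylor
   coefficients; the values of F outside the disc are irrelevant. *)
Definition hardy_disc (F : C_[R] -> C_[R]) : Prop :=
  exists2 c : nat -> C_[R],
    cvgn (series (fun n => Normc.normc (c n) ^+ 2)) &
    forall z : C_[R], Normc.normc z < 1 ->
      series (fun n => c n * z ^+ n) @ \oo --> F z.

Definition is_boundary_value (F : C_[R] -> C_[R]) (f : circle_fun R) :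
    Prop :=
  {ae arclength (R := R), forall t : R,
    F ((r%:C)%C * expi t) @[r --> (1 : R)^'-] --> (f t : C_[R])}.

Definition H2plus : set (circle_fun R) :=
  [set f | L2 f /\ exists2 F, hardy_disc F & is_boundary_value F f].

Definition H2minus : set (circle_fun R) := L2perp H2plus.

End HardySpaces.

(* Operators on L^2 are given by their graphs, relations between
   representatives that are compatible with almost everywhere equality:
   orth_proj M f g reads g = P_M f, paired_op a b f g reads g = S_{a,b} f and
   adjoint A f g reads g = A^* f. *)
Section Operators.
Context {R : realType}.
Implicit Types (M : set (circle_fun R)).
Implicit Types (A : circle_fun R -> circle_fun R -> Prop).
Implicit Types (a b f g : circle_fun R).

Definition orth_proj M f g : Prop := M g /\ L2perp M (fun t => f t - g t).

Definition paired_op a b f g : Prop :=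
  L2 g /\ exists p q,
    [/\ orth_proj H2plus f p, orth_proj H2minus f q &
        ae_eq_circle g (fun t => a t * p t + b t * q t)].

Definition adjoint A f g : Prop :=
  [/\ L2 f, L2 g & forall h k, A h k -> inner k f = inner h g].

Definition ker A : set (circle_fun R) := [set f | A f (cst 0)].

Definition null_space : set (circle_fun R) :=
  [set f | L2 f /\ ae_eq_circle f (cst 0)].

Definition symbol_pair a b : Prop :=
  [/\ Linfty a, Linfty b,
      {ae arclength (R := R), forall t, a t <> 0},
      {ae arclength (R := R), forall t, b t <> 0} &
      ae_eq_circle a b \/ {ae arclength (R := R), forall t, a t - b t <> 0}].

End Operators.

(* Main.v *)
(* For [p], [u] in [H2plus] and [q], [v] in [H2minus], an a.e. identity
   [u p = v q] has only nonnegative frequencies on the left and only negative ones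
   on the right, so every Cauchy product of the Fourier coefficients of [u] and [p]
   vanishes, and [u = 0] or [p = 0] since formal power series over a field form a
   domain. Multiplying [a p = - b q] (kernel of [S_(a,b)]) by the companion
   relation [b u = - a v] of the kernel of [S_(b,a)], or by [conj g] with [g] in
   the kernel of the adjoint (where [a conj g] and [b conj g] have spectra in
   [n > 0] and [n <= 0]), yields such an identity.

   The Fourier coefficients of a product of two L^2 functions are controlled by the
   density of trigonometric polynomials in L^2: the indicator of a ray is an a.e.
   bounded limit of trigonometric polynomials [(1 - y^n)^(2^n)], and a Dynkin
   argument extends this to all Borel sets. Negative Fourier coefficients of a
   radial boundary value vanish because, by Fatou's lemma, it is the L^2 limit of
   the Taylor polynomials. *)
Require Import Defs.
From mathcomp Require Import all_boot all_order all_algebra.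
From mathcomp Require Import all_classical all_reals all_analysis.
From mathcomp Require Import complex.
From mathcomp Require Import measurable_realfun ess_sup_inf finmap.
From mathcomp Require Import ring lra zify.

Set Implicit Arguments.
Unset Strict Implicit.
Unset Printing Implicit Defensive.

Import Order.TTheory GRing.Theory Num.Theory.
Import numFieldNormedType.Exports.

Local Open Scope classical_set_scope.
Local Open Scope ring_scope.

(** * Real and imaginary parts, measurability and squared norms *)

Section ComplexFunctions.
Context {R : realType}.
Implicit Types (f g h u p : circle_fun R) (z w : C_[R]).
Local Notation mu := (@arclength R).
Local Notation Re := complex.Re.
Local Notation Im := complex.Im.

Lemma conjE z : z^* = conjc z. Proof. by []. Qed.

Lemma Rec_conj z : Re z^* = Re z. Proof. by rewrite conjE; case: z. Qed.
Lemma Imc_conj z : Im z^* = - Im z. Proof. by rewrite conjE; case: z. Qed.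
Lemma RecD z w : Re (z + w) = Re z + Re w. Proof. by case: z; case: w. Qed.
Lemma ImcD z w : Im (z + w) = Im z + Im w. Proof. by case: z; case: w. Qed.
Lemma RecN z : Re (- z) = - Re z. Proof. by case: z. Qed.
Lemma ImcN z : Im (- z) = - Im z. Proof. by case: z. Qed.
Lemma RecM z w : Re (z * w) = Re z * Re w - Im z * Im w.
Proof. by case: z; case: w. Qed.
Lemma ImcM z w : Im (z * w) = Re z * Im w + Im z * Re w.
Proof. by case: z => a b; case: w => c d. Qed.

Lemma complex_ext z w : Re z = Re w -> Im z = Im w -> z = w.
Proof. by case: z => a b; case: w => c d /= -> ->. Qed.

Definition ReImE := (RecD, ImcD, RecN, ImcN, RecM, ImcM, Rec_conj, Imc_conj).

(** The squared modulus, kept as a real polynomial in the two coordinates: no square root occurs, so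
    algebraic identities reduce to [ring]. *)
Definition sqnorm z : R := Re z ^+ 2 + Im z ^+ 2.

Lemma sqnorm_ge0 z : 0 <= sqnorm z.
Proof. by rewrite addr_ge0// sqr_ge0. Qed.

Lemma sqnorm0 : sqnorm 0 = 0.
Proof. by rewrite /sqnorm/= expr0n/= addr0. Qed.

Lemma sqnorm_eq0 z : sqnorm z = 0 -> z = 0.
Proof.
rewrite /sqnorm => /eqP; rewrite paddr_eq0 ?sqr_ge0// !sqrf_eq0.
by move=> /andP[/eqP a /eqP b]; exact: complex_ext.
Qed.

Lemma sqnormM z w : sqnorm (z * w) = sqnorm z * sqnorm w.
Proof. by rewrite /sqnorm !ReImE; ring. Qed.

Lemma sqnormN z : sqnorm (- z) = sqnorm z.
Proof. by rewrite /sqnorm !ReImE; ring. Qed.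

Lemma sqnorm_conj z : sqnorm z^* = sqnorm z.
Proof. by rewrite /sqnorm !ReImE; ring. Qed.

Lemma sqnorm_real (x : R) : sqnorm x%:C%C = x ^+ 2.
Proof. by rewrite /sqnorm/= expr0n/= addr0. Qed.

Lemma sqnormD_le z w : sqnorm (z + w) <= 2 * sqnorm z + 2 * sqnorm w.
Proof.
rewrite /sqnorm !ReImE.
have h1 := sqr_ge0 (Re z - Re w); have h2 := sqr_ge0 (Im z - Im w).
by move: h1 h2; rewrite !sqrrB !sqrrD; lra.
Qed.

Lemma sqnorm_normc z : sqnorm z = Normc.normc z ^+ 2.
Proof. by case: z => a b; rewrite /sqnorm /= sqr_sqrtr// addr_ge0 ?sqr_ge0. Qed.

Lemma sqnormE z : z * z^* = (sqnorm z)%:C%C.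
Proof. by apply: complex_ext; rewrite /sqnorm !ReImE/=; ring. Qed.

Definition cmeasurable f :=
  measurable_fun [set: measurableTypeR R] (fun t => Re (f t) : R) /\
  measurable_fun [set: measurableTypeR R] (fun t => Im (f t) : R).

Lemma cmeasurable_cst z : cmeasurable (cst z).
Proof. by split; exact: measurable_cst. Qed.

Lemma cmeasurableD f g : cmeasurable f -> cmeasurable g ->
  cmeasurable (fun t => f t + g t).
Proof.
move=> [f1 f2] [g1 g2]; split.
- by under eq_fun do rewrite RecD; exact: measurable_funD.
- by under eq_fun do rewrite ImcD; exact: measurable_funD.
Qed.

Lemma cmeasurableM f g : cmeasurable f -> cmeasurable g ->
  cmeasurable (fun t => f t * g t).
Proof.
move=> [f1 f2] [g1 g2]; split.
- by under eq_fun do rewrite RecM; apply: measurable_funB; exact: measurable_funM.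
- by under eq_fun do rewrite ImcM; apply: measurable_funD; exact: measurable_funM.
Qed.

Lemma cmeasurableN f : cmeasurable f -> cmeasurable (fun t => - f t).
Proof.
move=> [f1 f2]; split.
- by under eq_fun do rewrite RecN; exact: measurableT_comp.
- by under eq_fun do rewrite ImcN; exact: measurableT_comp.
Qed.

Lemma cmeasurableB f g : cmeasurable f -> cmeasurable g ->
  cmeasurable (fun t => f t - g t).
Proof. by move=> mf mg; apply: cmeasurableD => //; exact: cmeasurableN. Qed.

Lemma cmeasurable_conj f : cmeasurable f -> cmeasurable (fun t => (f t)^*).
Proof.
move=> [f1 f2]; split.
- by under eq_fun do rewrite Rec_conj.
- by under eq_fun do rewrite Imc_conj; exact: measurableT_comp.
Qed.

Lemma cmeasurable_sqnorm f : cmeasurable f ->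
  measurable_fun [set: measurableTypeR R] (fun t => sqnorm (f t)).
Proof.
by move=> [f1 f2]; apply: measurable_funD; exact: measurable_funX.
Qed.

Lemma cmeasurable_real (x : R -> R) : measurable_fun [set: measurableTypeR R] x ->
  cmeasurable (fun t => (x t)%:C%C).
Proof. by move=> mx; split => //=; exact: measurable_cst. Qed.

Definition energy f : \bar R := (\int[mu]_t (sqnorm (f t))%:E)%E.

Lemma energy_ge0 f : (0 <= energy f)%E.
Proof. by apply: integral_ge0 => t _; rewrite lee_fin sqnorm_ge0. Qed.

(** The square of the L^2 norm is the energy, and squaring neither creates nor destroys
    finiteness. *)
Lemma L2P f : L2 f <-> cmeasurable f /\ (energy f < +oo)%E.
Proof.
have E : finite_norm mu 2%:E (fun t => Normc.normc (f t)) <-> (energy f < +oo)%E.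
  have -> : energy f = (\int[mu]_t (`|(Normc.normc (f t))%:E| `^ 2))%E.
    apply: eq_integral => t _; rewrite sqnorm_normc.
    by rewrite abse_EFin poweR_EFin powR_mulrn// ?normr_ge0// real_normK ?num_real.
  rewrite /finite_norm -(@poweR_Lnorm _ _ _ _ _ 2)//.
  split; first by move=> h; rewrite poweR_lty.
  move=> h; rewrite ltNge; apply/negP; rewrite leye_eq => /eqP N.
  by move: h; rewrite N poweRyr// ltxx.
rewrite /L2 /Lp /=; split.
- by move=> [m1 m2 /E].
- by move=> [[m1 m2] /E].
Qed.

End ComplexFunctions.

(** * Complex integrals and closure properties of L^2 *)

Section ComplexIntegral.
Context {R : realType}.
Implicit Types (f g h u v p : circle_fun R) (z w : C_[R]).
Local Notation mu := (@arclength R).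
Local Notation Re := complex.Re.
Local Notation Im := complex.Im.

Definition cintegrable f :=
  mu.-integrable setT (fun t => (Re (f t))%:E) /\
  mu.-integrable setT (fun t => (Im (f t))%:E).

Lemma cintegrable_cmeasurable f : cintegrable f -> cmeasurable f.
Proof.
by move=> [/measurable_int f1 /measurable_int f2]; split; exact/measurable_EFinP.
Qed.

Lemma cintegrable_le f (G : R -> R) : cmeasurable f ->
  mu.-integrable setT (fun t => (G t)%:E) ->
  (forall t, `|Re (f t)| <= G t) -> (forall t, `|Im (f t)| <= G t) ->
  cintegrable f.
Proof.
move=> [f1 f2] iG h1 h2; split; apply: (le_integrable _ _ _ iG) => //.
- exact/measurable_EFinP.
- by move=> t _; rewrite !abse_EFin lee_fin (le_trans (h1 t))// ler_norm.
- exact/measurable_EFinP.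
- by move=> t _; rewrite !abse_EFin lee_fin (le_trans (h2 t))// ler_norm.
Qed.

Lemma cintegralD f g : cintegrable f -> cintegrable g ->
  cintegral (fun t => f t + g t) = cintegral f + cintegral g.
Proof.
move=> [f1 f2] [g1 g2]; apply: complex_ext; rewrite ReImE/=.
- by under eq_Rintegral do rewrite RecD; rewrite RintegralD.
- by under eq_Rintegral do rewrite ImcD; rewrite RintegralD.
Qed.

Lemma cintegrableD f g : cintegrable f -> cintegrable g ->
  cintegrable (fun t => f t + g t).
Proof.
move=> [f1 f2] [g1 g2]; split.
- by under eq_fun do rewrite RecD EFinD; exact: integrableD.
- by under eq_fun do rewrite ImcD EFinD; exact: integrableD.
Qed.

Lemma cintegrableZ z f : cintegrable f -> cintegrable (fun t => z * f t).
Proof.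
move=> [f1 f2]; split.
- under eq_fun do rewrite RecM EFinB !EFinM.
  by apply: integrableB => //; exact: integrableZl.
- under eq_fun do rewrite ImcM EFinD !EFinM.
  by apply: integrableD => //; exact: integrableZl.
Qed.

Lemma cintegralZ z f : cintegrable f ->
  cintegral (fun t => z * f t) = z * cintegral f.
Proof.
move=> [f1 f2].
have Zl (k : R) (x : R -> R) : mu.-integrable setT (fun t => (x t)%:E) ->
    mu.-integrable setT (fun t => (k * x t)%:E).
  by move=> ix; under eq_fun do rewrite EFinM; exact: integrableZl.
apply: complex_ext; rewrite ReImE/=.
- by under eq_Rintegral do rewrite RecM; rewrite RintegralB ?RintegralZl//; exact: Zl.
- by under eq_Rintegral do rewrite ImcM; rewrite RintegralD ?RintegralZl//; exact: Zl.
Qed.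

Lemma cintegral0 : cintegral (fun=> 0 : C_[R]) = 0.
Proof.
by apply: complex_ext; rewrite /= /Rintegral integral0.
Qed.

Lemma cintegrable0 : cintegrable (fun=> 0 : C_[R]).
Proof. by split; exact: integrable0. Qed.

Lemma cintegralB f g : cintegrable f -> cintegrable g ->
  cintegral (fun t => f t - g t) = cintegral f - cintegral g.
Proof.
move=> cf cg; under [in LHS]eq_fun do rewrite -mulN1r.
by rewrite cintegralD ?cintegralZ ?mulN1r//; exact: cintegrableZ.
Qed.

Lemma cintegrable_sum (I : Type) (s : seq I) (F : I -> circle_fun R) :
  (forall i, cintegrable (F i)) -> cintegrable (fun t => \sum_(i <- s) F i t).
Proof.
move=> h; elim: s => [|i s IH].
  by under eq_fun do rewrite big_nil; exact: cintegrable0.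
by under eq_fun do rewrite big_cons; exact: cintegrableD.
Qed.

Lemma cintegral_sum (I : Type) (s : seq I) (F : I -> circle_fun R) :
  (forall i, cintegrable (F i)) ->
  cintegral (fun t => \sum_(i <- s) F i t) = \sum_(i <- s) cintegral (F i).
Proof.
move=> h; elim: s => [|i s IH].
  by under eq_fun do rewrite big_nil; rewrite cintegral0 big_nil.
under eq_fun do rewrite big_cons.
by rewrite cintegralD ?IH ?big_cons//; exact: cintegrable_sum.
Qed.

Lemma cintegral_conj f : cintegrable f ->
  cintegral (fun t => (f t)^*) = (cintegral f)^*.
Proof.
move=> [f1 f2]; apply: complex_ext; rewrite ReImE/=.
- by under eq_Rintegral do rewrite Rec_conj.
- under eq_Rintegral do rewrite Imc_conj -mulN1r.
  by rewrite RintegralZl// mulN1r.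
Qed.

Lemma ae_eq_cintegral f g : cmeasurable f -> cmeasurable g ->
  ae_eq_circle f g -> cintegral f = cintegral g.
Proof.
move=> [f1 f2] [g1 g2] fg; congr Complex; rewrite /Rintegral; congr fine;
  apply: ae_eq_integral => //; try exact/measurable_EFinP.
- by apply: filterS fg => t /= ->.
- by apply: filterS fg => t /= ->.
Qed.

Lemma L2_cmeasurable f : L2 f -> cmeasurable f.
Proof. by move=> /L2P[]. Qed.

Lemma integrable_sqnorm f : L2 f ->
  mu.-integrable setT (fun t => (sqnorm (f t))%:E).
Proof.
move=> /L2P[mf ef]; apply/integrableP; split.
  by apply/measurable_EFinP; exact: cmeasurable_sqnorm.
by under eq_integral do rewrite gee0_abs ?lee_fin ?sqnorm_ge0//.
Qed.

Lemma L2_le f (G : R -> R) : cmeasurable f ->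
  mu.-integrable setT (fun t => (G t)%:E) ->
  {ae mu, forall t, sqnorm (f t) <= G t} -> L2 f.
Proof.
move=> mf /integrableP[mG iG] h; apply/L2P; split => //.
apply: le_lt_trans iG; apply: ae_ge0_le_integral => //.
- by move=> t _; rewrite lee_fin sqnorm_ge0.
- by apply/measurable_EFinP; exact: cmeasurable_sqnorm.
- exact: measurableT_comp.
- by apply: filterS h => t /= h _; rewrite lee_fin (le_trans h)// ler_norm.
Qed.

Lemma L2D f g : L2 f -> L2 g -> L2 (fun t => f t + g t).
Proof.
move=> lf lg; apply: (@L2_le _ (fun t => 2 * sqnorm (f t) + 2 * sqnorm (g t))).
- by apply: cmeasurableD; exact: L2_cmeasurable.
- under eq_fun do rewrite EFinD !EFinM.
  by apply: integrableD => //; apply: integrableZl => //; exact: integrable_sqnorm.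
- by apply: aeW => t; exact: sqnormD_le.
Qed.

Lemma L2_bounded f g (M : R) : cmeasurable f -> {ae mu, forall t, sqnorm (f t) <= M} ->
  L2 g -> L2 (fun t => f t * g t).
Proof.
move=> mf fM lg; apply: (@L2_le _ (fun t => M * sqnorm (g t))).
- by apply: cmeasurableM => //; exact: L2_cmeasurable.
- by under eq_fun do rewrite EFinM; apply: integrableZl => //; exact: integrable_sqnorm.
- by apply: filterS fM => t fM; rewrite sqnormM ler_wpM2r// sqnorm_ge0.
Qed.

Lemma L2Z z f : L2 f -> L2 (fun t => z * f t).
Proof.
move=> lf; apply: (@L2_bounded (cst z) _ (sqnorm z)) => //.
exact: aeW.
Qed.

Lemma L2B f g : L2 f -> L2 g -> L2 (fun t => f t - g t).
Proof.
move=> lf lg; have := L2D lf (L2Z (-1) lg).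
by under eq_fun do rewrite mulN1r.
Qed.

Lemma L2_conj f : L2 f -> L2 (fun t => (f t)^*).
Proof.
move=> lf; apply: (@L2_le _ (fun t => sqnorm (f t))).
- by apply: cmeasurable_conj; exact: L2_cmeasurable.
- exact: integrable_sqnorm.
- by apply: aeW => t; rewrite sqnorm_conj.
Qed.

Lemma L2_cst z : L2 (cst z : circle_fun R).
Proof.
apply: (@L2_le _ (cst (sqnorm z))).
- exact: cmeasurable_cst.
- exact: finite_measure_integrable_cst.
- exact: aeW.
Qed.

Lemma L2_sum (I : Type) (s : seq I) (F : I -> circle_fun R) :
  (forall i, L2 (F i)) -> L2 (fun t => \sum_(i <- s) F i t).
Proof.
move=> h; elim: s => [|i s IH].
  by under eq_fun do rewrite big_nil; exact: (L2_cst 0).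
by under eq_fun do rewrite big_cons; exact: L2D.
Qed.

Lemma Linfty_bounded f : Linfty f ->
  cmeasurable f /\ exists M, {ae mu, forall t, sqnorm (f t) <= M}.
Proof.
move=> [f1 f2]; rewrite /finite_norm unlock /= probability_setT lte01 => h.
split => //.
have [M [hM _]] : exists M : R,
    (ess_sup mu (abse \o (EFin \o (fun t => Normc.normc (f t)))) <= M%:E)%E /\ True.
  (* The essential supremum is real, or [+oo] (excluded by [h]), or [-oo]; in the last case any real
     is a bound and [0] is taken. *)
  move: h; case: (ess_sup _ _) => [r _|//|_]; first by exists r.
  by exists 0; rewrite leNye.
exists (M ^+ 2); move/ess_supP : hM; apply: filterS => t /=.
rewrite lee_fin => h'; rewrite sqnorm_normc -real_normK ?num_real//.
by rewrite ler_sqr ?nnegrE// (le_trans _ h').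
Qed.

Lemma Linfty_L2 f g : Linfty f -> L2 g -> L2 (fun t => f t * g t).
Proof. by move=> /Linfty_bounded[mf [M fM]]; exact: L2_bounded fM. Qed.

(** The squares of [k * a - b] and [k * a + b] are nonnegative; divided by [k] and expanded, they
    bound [a * b] from either side. *)
Let AM_GM (k a b : R) : 0 < k -> `|a * b| <= (k * a ^+ 2 + b ^+ 2 / k) / 2.
Proof.
move=> k0.
have h1 : 0 <= (k * a - b) ^+ 2 / k by rewrite divr_ge0 ?sqr_ge0// ltW.
have h2 : 0 <= (k * a + b) ^+ 2 / k by rewrite divr_ge0 ?sqr_ge0// ltW.
have e1 : (k * a - b) ^+ 2 / k = k * a ^+ 2 - 2 * (a * b) + b ^+ 2 / k.
  by field; rewrite gt_eqF.
have e2 : (k * a + b) ^+ 2 / k = k * a ^+ 2 + 2 * (a * b) + b ^+ 2 / k.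
  by field; rewrite gt_eqF.
rewrite e1 in h1; rewrite e2 in h2; rewrite ler_norml; apply/andP; split; lra.
Qed.

Lemma RecM_le (k : R) z w : 0 < k -> `|Re (z * w)| <= k * sqnorm z + sqnorm w / k.
Proof.
move=> k0; rewrite RecM; apply: le_trans (ler_normB _ _) _.
have := AM_GM (Re z) (Re w) k0; have := AM_GM (Im z) (Im w) k0.
have : 0 <= k * sqnorm z by rewrite mulr_ge0 ?sqnorm_ge0// ltW.
have : 0 <= sqnorm w / k by rewrite divr_ge0 ?sqnorm_ge0// ltW.
rewrite /sqnorm mulrDl mulrDr; lra.
Qed.

Lemma ImcM_le (k : R) z w : 0 < k -> `|Im (z * w)| <= k * sqnorm z + sqnorm w / k.
Proof.
move=> k0; rewrite ImcM; apply: le_trans (ler_normD _ _) _.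
have := AM_GM (Re z) (Im w) k0; have := AM_GM (Im z) (Re w) k0.
have : 0 <= k * sqnorm z by rewrite mulr_ge0 ?sqnorm_ge0// ltW.
have : 0 <= sqnorm w / k by rewrite divr_ge0 ?sqnorm_ge0// ltW.
rewrite /sqnorm mulrDl mulrDr; lra.
Qed.

Let integrable_comb (k : R) u v : L2 u -> L2 v ->
  mu.-integrable setT (fun t => (k * sqnorm (u t) + sqnorm (v t) / k)%:E).
Proof.
move=> lu lv; under eq_fun do rewrite EFinD EFinM mulrC EFinM.
by apply: integrableD => //; apply: integrableZl => //; exact: integrable_sqnorm.
Qed.

Lemma cintegrableM u v : L2 u -> L2 v -> cintegrable (fun t => u t * v t).
Proof.
move=> lu lv; apply: (cintegrable_le _ (integrable_comb 1 lu lv)).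
- by apply: cmeasurableM; exact: L2_cmeasurable.
- by move=> t; exact: RecM_le.
- by move=> t; exact: ImcM_le.
Qed.

(** This takes the place of the Cauchy-Schwarz inequality. The pointwise weighted bounds are
    integrated, and the weight [k] stays free so that a later choice makes both terms small. *)
Lemma cintegralM_le (k : R) u v : L2 u -> L2 v -> 0 < k ->
  `|Re (cintegral (fun t => u t * v t))|
    <= k * fine (energy u) + fine (energy v) / k /\
  `|Im (cintegral (fun t => u t * v t))|
    <= k * fine (energy u) + fine (energy v) / k.
Proof.
move=> lu lv k0.
have [i1 i2] := cintegrableM lu lv.
have ic := integrable_comb k lu lv.
have -> : k * fine (energy u) + fine (energy v) / k =
    \int[mu]_t (k * sqnorm (u t) + sqnorm (v t) / k).
  have iu := integrable_sqnorm lu; have iv := integrable_sqnorm lv.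
  have i1' : mu.-integrable setT (fun t => (k * sqnorm (u t))%:E).
    by under eq_fun do rewrite EFinM; exact: integrableZl.
  have i2' : mu.-integrable setT (fun t => (sqnorm (v t) / k)%:E).
    by under eq_fun do rewrite mulrC EFinM; exact: integrableZl.
  rewrite RintegralD//.
  by rewrite RintegralZl// RintegralZr.
have nrm (x : R -> R) : mu.-integrable setT (fun t => (x t)%:E) ->
    mu.-integrable setT (fun t => (`|x t|)%:E) by move=> /integrable_norm.
split; apply: le_trans (le_normr_Rintegral _ _) _ => //;
  apply: le_Rintegral => //; try exact: nrm.
- by move=> t _; exact: RecM_le.
- by move=> t _; exact: ImcM_le.
Qed.

(** Integration against [u] is continuous in the L^2 norm, so its vanishing passes from arbitrarily
    close [g] to [p]. *)
Lemma cintegralM_eq0 u p : L2 u -> L2 p ->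
  (forall e : R, 0 < e -> exists g, [/\ L2 g,
     fine (energy (fun t => p t - g t)) < e & cintegral (fun t => u t * g t) = 0]) ->
  cintegral (fun t => u t * p t) = 0.
Proof.
move=> lu lp H.
have E0 : 0 <= fine (energy u) by rewrite fine_ge0// energy_ge0.
have key d : 0 < d -> `|Re (cintegral (fun t => u t * p t))| <= d /\
                      `|Im (cintegral (fun t => u t * p t))| <= d.
  (* This [k] brings the term with the energy of [u] below [d / 2], and the tolerance [k * (d / 2)]
     for [g] does the same for the other term. The [+ 1] keeps the denominator positive when [u] has
     zero energy. *)
  move=> d0; pose k := d / (2 * (fine (energy u) + 1)).
  have k0 : 0 < k by rewrite divr_gt0// mulr_gt0// ltr_wpDl.
  have [g [lg eg ug]] := H (k * (d / 2)) (mulr_gt0 k0 (divr_gt0 d0 (ltr0n _ 2))).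
  have lpg := L2B lp lg.
  have -> : cintegral (fun t => u t * p t) = cintegral (fun t => u t * (p t - g t)).
    under [in RHS]eq_fun do rewrite mulrBr.
    by rewrite cintegralB ?ug ?subr0//; exact: cintegrableM.
  have B : k * fine (energy u) + fine (energy (fun t => p t - g t)) / k <= d.
    have h1 : k * fine (energy u) <= d / 2.
      rewrite /k mulrAC ler_pdivrMr ?mulr_gt0// ?ltr_wpDl//.
      by rewrite mulrA divfK// ler_pM2l// lerDl.
    have h2 : fine (energy (fun t => p t - g t)) / k <= d / 2.
      by rewrite ler_pdivrMr// mulrC ltW.
    lra.
  have [a b] := cintegralM_le lu lpg k0.
  by split; apply: le_trans B.
apply: complex_ext; apply/eqP; rewrite -normr_le0; apply/ler_addgt0Pl => d d0;
  by rewrite addr0; case: (key _ d0).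
Qed.

End ComplexIntegral.

(** * The characters of the circle and their integrals *)

Section Exponentials.
Context {R : realType}.
Implicit Types (f g h u v p : circle_fun R) (z w : C_[R]) (t : R) (n m : int).
Local Notation mu := (@arclength R).
Local Notation Re := complex.Re.
Local Notation Im := complex.Im.

Definition cexp n : circle_fun R := fun t => expi (n%:~R * t).

Lemma expiD t s : expi (t + s) = expi t * expi s :> C_[R].
Proof. by apply: complex_ext; rewrite ?RecM ?ImcM/= ?cosD ?sinD//; ring. Qed.

Lemma cexpD n m t : cexp (n + m) t = cexp n t * cexp m t.
Proof. by rewrite /cexp intrD mulrDl expiD. Qed.

Lemma cexp0 t : cexp 0 t = 1.
Proof. by apply: complex_ext; rewrite /= mul0r ?cos0 ?sin0. Qed.

Lemma cexpN n t : cexp (- n) t = (cexp n t)^*.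
Proof. by apply: complex_ext; rewrite ?Rec_conj ?Imc_conj/= intrN mulNr ?cosN ?sinN. Qed.

Lemma cexp_nat (n : nat) t : cexp n t = expi t ^+ n.
Proof.
elim: n => [|n IH]; first by rewrite cexp0 expr0.
by rewrite -addn1 PoszD cexpD IH exprD expr1 /cexp mul1r.
Qed.

Lemma sqnorm_cexp n t : sqnorm (cexp n t) = 1.
Proof. by rewrite /sqnorm /= cos2Dsin2. Qed.

Lemma cmeasurable_cexp n : cmeasurable (cexp n).
Proof.
have h : measurable_fun [set: measurableTypeR R] (fun t : R => n%:~R * t).
  exact: measurable_funM.
split => /=.
- apply: measurableT_comp h; apply: continuous_measurable_fun.
  exact: continuous_cos.
- apply: measurableT_comp h; apply: continuous_measurable_fun.
  exact: continuous_sin.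
Qed.

Lemma L2_cexpM n f : L2 f -> L2 (fun t => cexp n t * f t).
Proof.
move=> lf; apply: (@L2_bounded _ _ _ 1) => //; first exact: cmeasurable_cexp.
by apply: aeW => t; rewrite sqnorm_cexp.
Qed.

Lemma L2_cexp n : L2 (cexp n).
Proof.
have := L2_cexpM n (L2_cst 1); under eq_fun do rewrite mulr1; exact.
Qed.

(** Fundamental theorem of calculus on [[0, 2 * pi]]. It is applied to [1 + f], whose nonnegativity
    comes from the bound on [f], because the integral formula for the uniform law takes a
    nonnegative integrand. *)
Lemma Rintegral_arclength_eq0 (f F : R -> R) : (forall t, `|f t| <= 1) ->
  continuous f -> (forall t, is_derive t 1 F (f t)) -> F (2 * pi) = F 0 ->
  Rintegral mu setT f = 0.
Proof.
move=> f1 cf dF FE.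
have mf : measurable_fun [set: measurableTypeR R] f.
  exact: continuous_measurable_fun.
have i1 : mu.-integrable setT (fun t => (1%R : R)%:E).
  exact: finite_measure_integrable_cst.
have if_ : mu.-integrable setT (fun t => (f t)%:E).
  apply: (le_integrable _ _ _ i1) => //; first exact/measurable_EFinP.
  by move=> t _; rewrite !abse_EFin lee_fin normr1.
have : Rintegral mu setT (fun t => 1 + f t) = 1.
  rewrite /Rintegral /arclength integral_uniform; first last.
  - by move=> t; rewrite lee_fin; have := f1 t; rewrite ler_norml; lra.
  - by apply/measurable_EFinP; exact: measurable_funD.
  have dG t : is_derive t 1 (fun t : R => t + F t) (1 + f t).
    by have := dF t => ?; exact: is_deriveD.
  have cG : continuous (fun t => t + F t).
    by move=> t; apply/differentiable_continuous/derivable1_diffP; exact: ex_derive.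
  rewrite (@continuous_FTC2 _ _ (fun t => t + F t)).
  - rewrite FE -EFinB -EFinM/= subr0 add0r addrK mulVf//.
    by rewrite gt_eqF// twopi_gt0.
  - exact: twopi_gt0.
  - by apply: continuous_subspaceT => t; apply: cvgD; [exact: cvg_cst|exact: cf].
  - split.
    + by move=> t _; exact: ex_derive.
    + apply: cvg_at_right_filter; exact: cG.
    + apply: cvg_at_left_filter; exact: cG.
  - by move=> t _; rewrite derive1E; exact: derive_val.
rewrite RintegralD// Rintegral_cst// [X in fine X]probability_setT mulr1.
by move/eqP; rewrite addrC -subr_eq0 addrK => /eqP.
Qed.

Lemma sin_cos_2pin n : sin (n%:~R * (2 * pi)) = 0 :> R /\ cos (n%:~R * (2 * pi)) = 1 :> R.
Proof.
have h (k : nat) : sin (k%:R * (2 * pi)) = 0 :> R /\ cos (k%:R * (2 * pi)) = 1 :> R.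
  have -> : k%:R * (2 * pi) = 0 + (pi *+ 2) *+ k :> R.
    by rewrite add0r -mulr_natl [pi *+ 2]mulr2n; ring.
  rewrite (periodicn (@sinD2pi R)) (periodicn (@cosD2pi R)) sin0 cos0.
  by split.
case: n => k; first exact: h.
by rewrite NegzE intrN mulNr sinN cosN; case: (h k.+1) => -> ->; rewrite oppr0.
Qed.

(** For [n != 0] the primitives [sin (n t) / n] and [- cos (n t) / n] of the two coordinates agree
    at [0] and [2 * pi]. *)
Lemma cintegral_cexp n : cintegral (cexp n) = (n == 0)%:R.
Proof.
have [->|n0] := eqVneq n 0.
  apply: complex_ext => /=; under eq_Rintegral do rewrite mul0r ?cos0 ?sin0.
    by rewrite Rintegral_cst// [X in fine X]probability_setT mulr1.
  by rewrite Rintegral_cst// [X in fine X]probability_setT mulr1.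
have r0 : n%:~R != 0 :> R by rewrite intr_eq0.
have dl t : is_derive t 1 (fun t : R => n%:~R * t) n%:~R.
  by apply: is_derive_eq; rewrite /GRing.scale/= ?mulr1 ?mulr0 ?addr0.
have cl : continuous (fun t : R => n%:~R * t).
  by move=> t; apply: cvgM; [exact: cvg_cst|exact: cvg_id].
apply: complex_ext => /=.
- apply: (@Rintegral_arclength_eq0 _ (fun t => n%:~R^-1 * sin (n%:~R * t))).
  + by move=> t; exact: cos_max.
  + by move=> t; apply: continuous_comp; [exact: cl|exact: continuous_cos].
  + move=> t; apply: is_derive_eq; rewrite /GRing.scale/= ?mulr0 ?addr0 ?mulr1.
    by rewrite -[cos _]/(cos _) mulrCA mulVf// mulr1.
  + by rewrite mulr0 sin0; have [-> _] := sin_cos_2pin n.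
- apply: (@Rintegral_arclength_eq0 _ (fun t => - (n%:~R^-1 * cos (n%:~R * t)))).
  + by move=> t; exact: sin_max.
  + by move=> t; apply: continuous_comp; [exact: cl|exact: continuous_sin].
  + move=> t; apply: is_derive_eq; rewrite /GRing.scale/= ?mulr0 ?addr0 ?mulr1.
    by rewrite mulNr mulrN opprK mulrCA mulVf// mulr1.
  + by rewrite mulr0 cos0; have [_ ->] := sin_cos_2pin n.
Qed.

End Exponentials.

(** * Bernoulli's inequality and a polynomial approximation of a step *)

Section Bernoulli.
Context {R : realType}.
Implicit Types (a y : R) (m n : nat).

Lemma bernoulli_ge a m : 0 <= a -> 1 + m%:R * a <= (1 + a) ^+ m.
Proof.
move=> a0; elim: m => [|m IH]; first by rewrite mul0r addr0 expr0.
rewrite exprSr; have h : 0 <= m%:R * a * a by rewrite !mulr_ge0.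
apply: (@le_trans _ _ ((1 + m%:R * a) * (1 + a))).
  by rewrite -natr1 mulrDl mul1r; move: h; lra.
by rewrite ler_wpM2r// addr_ge0.
Qed.

Lemma bernoulli_onem_ge a m : 0 <= a <= 1 -> 1 - m%:R * a <= (1 - a) ^+ m.
Proof.
move=> /andP[a0 a1]; elim: m => [|m IH]; first by rewrite mul0r subr0 expr0.
rewrite exprSr; have h : 0 <= m%:R * a * a by rewrite !mulr_ge0.
apply: (@le_trans _ _ ((1 - m%:R * a) * (1 - a))).
  by rewrite -natr1; move: h; lra.
by rewrite ler_wpM2r// subr_ge0.
Qed.

(* As [n] tends to infinity, [steep y n] tends to [1] for [y < 1/2] and to [0] for
   [y > 1/2], by Bernoulli's inequality applied to [2 ^ n * y ^ n = (2 * y) ^ n]. *)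
Definition steep y n : R := (1 - y ^+ n) ^+ (2 ^ n).

Lemma steep_itv y n : 0 <= y <= 1 -> 0 <= steep y n <= 1.
Proof.
move=> /andP[y0 y1]; have h : 0 <= y ^+ n <= 1 by rewrite exprn_ge0//= exprn_ile1.
by rewrite exprn_ge0 ?exprn_ile1//; lra.
Qed.

Lemma steep_cvg1 y : 0 <= y < 2^-1 -> steep y n @[n --> \oo] --> (1 : R).
Proof.
move=> /andP[y0 y2].
have y1 : 0 <= y <= 1 by lra.
apply: (@squeeze_cvgr _ _ _ _ (fun n => 1 - (2 * y) ^+ n) (cst 1)).
- near=> n; have /andP[_ ->] := steep_itv n y1; rewrite andbT.
  apply: le_trans (bernoulli_onem_ge _ _).
    by rewrite natrX exprMn.
  by case/andP: y1 => _ y1; rewrite exprn_ge0//= exprn_ile1.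
- rewrite -[X in _ --> X]subr0; apply: cvgB; first exact: cvg_cst.
  by apply: cvg_expr; rewrite ger0_norm; lra.
- exact: cvg_cst.
Unshelve. all: by end_near. Qed.

Lemma steep_cvg0 y : 2^-1 < y <= 1 -> steep y n @[n --> \oo] --> (0 : R).
Proof.
move=> /andP[y2 y1'].
have y1 : 0 <= y <= 1 by lra.
have yy : 1 < 2 * y by lra.
apply: (@squeeze_cvgr _ _ _ _ (cst 0) (fun n => (2 * y)^-1 ^+ n)).
- near=> n; have /andP[-> _] := steep_itv n y1 => /=.
  have a0 : 0 <= y ^+ n by rewrite exprn_ge0//; lra.
  have a1 : y ^+ n <= 1 by rewrite exprn_ile1//; lra.
  have P : 0 < (2 * y) ^+ n by rewrite exprn_gt0//; lra.
  rewrite exprVn -[leRHS]mul1r ler_pdivlMr//.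
  (* The factor [(1 + y ^+ n) ^+ (2 ^ n)] is at least [(2 * y) ^+ n] by Bernoulli, and its product
     with [steep y n] is a power of [1 - y ^ (2 n)], hence at most [1]. *)
  apply: (@le_trans _ _ ((1 - y ^+ n) ^+ (2 ^ n) * (1 + y ^+ n) ^+ (2 ^ n))).
    rewrite ler_wpM2l// ?exprn_ge0 ?subr_ge0//.
    apply: le_trans (bernoulli_ge _ a0).
    by rewrite natrX exprMn lerDr.
  rewrite -exprMn exprn_ile1//.
    by rewrite mulr_ge0// ?subr_ge0// addr_ge0.
  have := sqr_ge0 (y ^+ n); rewrite expr2; lra.
- exact: cvg_cst.
- by apply: cvg_expr; rewrite ger0_norm ?invr_ge0 ?invf_lt1//; lra.
Unshelve. all: by end_near. Qed.

End Bernoulli.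

(** * Trigonometric polynomials and their closure in L^2 *)

Section Density.
Context {R : realType}.
Implicit Types (f g h u v p T : circle_fun R) (z w : C_[R]) (x : R).
Local Notation mu := (@arclength R).
Local Notation Re := complex.Re.
Local Notation Im := complex.Im.

(** A Laurent polynomial in [expi t], written as a negative power times a genuine polynomial, so
    that sums and products reduce to polynomial arithmetic. *)
Definition trigpoly T := exists (N : nat) (P : {poly C_[R]}),
  forall t, T t = cexp (- N%:Z) t * P.[expi t].

Lemma cexpK (N : nat) (t : R) : cexp (- N%:Z) t * expi t ^+ N = 1.
Proof. by rewrite -cexp_nat -cexpD addNr cexp0. Qed.

Lemma trigpolyD T1 T2 : trigpoly T1 -> trigpoly T2 ->
  trigpoly (fun t => T1 t + T2 t).
Proof.
(* Both summands are brought to the common denominator [expi t ^+ (N1 + N2)]. *)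
move=> [N1 [P1 h1]] [N2 [P2 h2]]; exists (N1 + N2)%N, (P1 * 'X^N2 + P2 * 'X^N1) => t.
rewrite h1 h2 PoszD opprD cexpD !hornerE.
transitivity (cexp (- N1%:Z) t * P1.[expi t] * (cexp (- N2%:Z) t * expi t ^+ N2) +
  cexp (- N2%:Z) t * P2.[expi t] * (cexp (- N1%:Z) t * expi t ^+ N1)); last by ring.
by rewrite !cexpK !mulr1.
Qed.

Lemma trigpolyM T1 T2 : trigpoly T1 -> trigpoly T2 ->
  trigpoly (fun t => T1 t * T2 t).
Proof.
move=> [N1 [P1 h1]] [N2 [P2 h2]]; exists (N1 + N2)%N, (P1 * P2) => t.
by rewrite h1 h2 PoszD opprD cexpD hornerM; ring.
Qed.

Lemma trigpoly_cst z : trigpoly (cst z).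
Proof. by exists 0, z%:P => t; rewrite oppr0 cexp0 hornerC mul1r. Qed.

Lemma trigpolyX T k : trigpoly T -> trigpoly (fun t => T t ^+ k).
Proof.
move=> hT; elim: k => [|k IH].
  by under eq_fun do rewrite expr0; exact: trigpoly_cst.
by under eq_fun do rewrite exprS; exact: trigpolyM.
Qed.

Lemma trigpoly_cexp1 : trigpoly (cexp 1).
Proof. by exists 0, 'X => t; rewrite oppr0 cexp0 hornerX mul1r /cexp mul1r. Qed.

Lemma trigpoly_cexpN1 : trigpoly (cexp (-1)).
Proof. by exists 1, 1%:P => t; rewrite hornerC mulr1. Qed.

(** Reading off the coefficients of the polynomial gives the linear-combination form, to which
    orthogonality of the characters applies. *)
Lemma trigpoly_sum T : trigpoly T -> exists (N m : nat) (c : nat -> C_[R]),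
  T = (fun t => \sum_(i < m) c i * cexp (i%:Z - N%:Z) t).
Proof.
move=> [N [P h]]; exists N, (size P), (fun i => P`_i); apply/funext => t.
rewrite h horner_coef mulr_sumr; apply: eq_bigr => i _.
by rewrite addrC cexpD cexp_nat; ring.
Qed.

Lemma L2_trigpoly T : trigpoly T -> L2 T.
Proof.
move=> /trigpoly_sum[N [m [c ->]]]; apply: L2_sum => i.
exact/L2Z/L2_cexp.
Qed.

(** The substitute for the triangle inequality; its factors [2] are the reason for the tolerances
    [e / 4] below. *)
Lemma energyD_le f g : L2 f -> L2 g ->
  fine (energy (fun t => f t + g t)) <= 2 * fine (energy f) + 2 * fine (energy g).
Proof.
move=> lf lg; have if_ := integrable_sqnorm lf; have ig := integrable_sqnorm lg.
have h (u : circle_fun R) : L2 u ->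
    mu.-integrable setT (fun t => (2 * sqnorm (u t))%:E).
  by move=> lu; under eq_fun do rewrite EFinM; apply: integrableZl => //; exact: integrable_sqnorm.
have -> : 2 * fine (energy f) + 2 * fine (energy g) =
    \int[mu]_t (2 * sqnorm (f t) + 2 * sqnorm (g t)).
  by rewrite RintegralD ?RintegralZl//; exact: h.
apply: le_Rintegral => //.
- exact/integrable_sqnorm/L2D.
- exact: (integrableD measurableT (h _ lf) (h _ lg)).
- by move=> t _; exact: sqnormD_le.
Qed.

Lemma energyZ z f : L2 f -> fine (energy (fun t => z * f t)) = sqnorm z * fine (energy f).
Proof.
move=> lf; rewrite -RintegralZl//; last exact: integrable_sqnorm.
by apply: eq_Rintegral => t _; rewrite sqnormM.
Qed.

(** Membership in the L^2 closure of the trigonometric polynomials. *)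
Definition approximable f := L2 f /\ forall e : R, 0 < e ->
  exists T, trigpoly T /\ fine (energy (fun t => f t - T t)) < e.

Lemma approximable_trigpoly T : trigpoly T -> approximable T.
Proof.
move=> hT; split; first exact: L2_trigpoly.
move=> e e0; exists T; split => //.
rewrite /energy; under eq_integral do rewrite subrr sqnorm0.
by rewrite integral0.
Qed.

Lemma approximable_lim f : L2 f ->
  (forall e : R, 0 < e -> exists g, approximable g /\ fine (energy (fun t => f t - g t)) < e) ->
  approximable f.
Proof.
move=> lf H; split => // e e0.
have e4 : 0 < e / 4 by rewrite divr_gt0.
have [g [[lg gT] fg]] := H _ e4; have [T [hT gTe]] := gT _ e4; exists T; split => //.
have := energyD_le (L2B lf lg) (L2B lg (L2_trigpoly hT)).
under eq_fun do rewrite subrKA.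
by move/le_lt_trans; apply; lra.
Qed.

Lemma approximableD f g : approximable f -> approximable g ->
  approximable (fun t => f t + g t).
Proof.
move=> [lf hf] [lg hg]; split; first exact: L2D.
move=> e e0; have e4 : 0 < e / 4 by rewrite divr_gt0.
have [T1 [t1 h1]] := hf _ e4; have [T2 [t2 h2]] := hg _ e4.
exists (fun t => T1 t + T2 t); split; first exact: trigpolyD.
have := energyD_le (L2B lf (L2_trigpoly t1)) (L2B lg (L2_trigpoly t2)).
under eq_fun do rewrite addrACA -opprD.
by move/le_lt_trans; apply; lra.
Qed.

Lemma approximableZ z f : approximable f -> approximable (fun t => z * f t).
Proof.
(* Dividing by [sqnorm z + 1] instead of [sqnorm z] also covers [z = 0]. *)
move=> [lf hf]; split; first exact: L2Z.
move=> e e0; have z0 : 0 < sqnorm z + 1 by rewrite ltr_wpDl// sqnorm_ge0.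
have [T [hT h]] := hf _ (divr_gt0 e0 z0).
exists (fun t => z * T t); split.
  by apply: trigpolyM => //; exact: trigpoly_cst.
under eq_fun do rewrite -mulrBr.
rewrite energyZ; last by apply: L2B => //; exact: L2_trigpoly.
move: h; rewrite ltr_pdivlMr// mulrDr mulr1 mulrC; apply: le_lt_trans.
by rewrite lerDl fine_ge0// energy_ge0.
Qed.

Lemma approximable_sum (I : Type) (s : seq I) (F : I -> circle_fun R) :
  (forall i, approximable (F i)) -> approximable (fun t => \sum_(i <- s) F i t).
Proof.
move=> h; elim: s => [|i s IH].
  by under eq_fun do rewrite big_nil; apply: approximable_trigpoly; exact: (trigpoly_cst 0).
by under eq_fun do rewrite big_cons; exact: approximableD.
Qed.

(** Dominated convergence applied to [sqnorm (f t - F n t)]: it tends to [0] and is at most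
    [2 * G t + 2 * G t], whence the majorant [4 * G t]. *)
Lemma approximable_dominated (F : nat -> circle_fun R) f (G : R -> R) :
  cmeasurable f -> (forall n, approximable (F n)) ->
  mu.-integrable setT (fun t => (G t)%:E) ->
  {ae mu, forall t, forall n, sqnorm (F n t) <= G t} ->
  {ae mu, forall t, sqnorm (f t) <= G t} ->
  {ae mu, forall t, sqnorm (f t - F n t) @[n --> \oo] --> (0 : R)} ->
  approximable f.
Proof.
move=> mf aF iG FG fG Ff.
have lf : L2 f by exact: L2_le iG fG.
apply: approximable_lim => // e e0.
have i4G : mu.-integrable setT (fun t => (4 * G t)%:E).
  by under eq_fun do rewrite EFinM; exact: integrableZl.
have mF n : measurable_fun [set: measurableTypeR R] (fun t => (sqnorm (f t - F n t))%:E).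
  apply/measurable_EFinP.
  exact: (cmeasurable_sqnorm (cmeasurableB mf (L2_cmeasurable (aF n).1))).
have cvF : {ae mu, forall t, setT t ->
    (fun n => (sqnorm (f t - F n t))%:E) @ \oo --> (cst 0%E : R -> \bar R) t}.
  by apply: filterS Ff => t h _; apply: cvg_EFin; [exact: nearW|exact: h].
have leF : {ae mu, forall t, forall n, setT t ->
    (`|(sqnorm (f t - F n t))%:E| <= (4 * G t)%:E)%E}.
  move: FG fG; apply: filterS2 => t h1 h2 n _.
  rewrite abse_EFin lee_fin ger0_norm ?sqnorm_ge0//.
  apply: le_trans (sqnormD_le _ _) _; rewrite sqnormN.
  by have := h1 n; move: h2; lra.
have [_ _] := dominated_convergence measurableT mF (measurable_cst _) cvF i4G leF.
rewrite integral0 => /fine_cvgP[_ /cvgrPdist_lt/(_ _ e0)].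
case => n _ /(_ n (leqnn n)) h; exists (F n); split => //.
move: h; rewrite sub0r normrN ger0_norm//.
by apply: fine_ge0; exact: energy_ge0.
Qed.

End Density.

(** * Density of the trigonometric polynomials in L^2 *)

Section DensityL2.
Context {R : realType}.
Implicit Types (f g h u v p T : circle_fun R) (z w : C_[R]) (x : R).
Local Notation mu := (@arclength R).
Local Notation Re := complex.Re.
Local Notation Im := complex.Im.

(** Arclength is dominated by Lebesgue measure, so points are null, and its density vanishes off
    [[0, 2 * pi]]. *)
Lemma ae_arclength_oo x : {ae mu, forall t : measurableTypeR R, [/\ 0 < t, t < 2 * pi & t != x]}.
Proof.
have m1 (a : R) : mu [set a] = 0%E.
  have /null_content_dominatesP := dominates_uniform_prob (@twopi_gt0 R).
  apply => //.
  exact: lebesgue_measure_set1.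
have m2 : mu (~` `[0, 2 * pi]%classic) = 0%E.
  change (uniform_prob (@twopi_gt0 R) (~` `[0, 2 * pi]%classic) = 0%E).
  by rewrite /uniform_prob integral_uniform_pdf setICl integral_set0.
exists (~` `[0, 2 * pi]%classic `|` [set 0] `|` [set 2 * pi] `|` [set x]); split.
- by apply: measurableU => //; apply: measurableU => //; apply: measurableU => //;
    apply: measurableC.
- have U (A B : set (measurableTypeR R)) : measurable A -> measurable B ->
      mu A = 0%E -> mu B = 0%E -> mu (A `|` B) = 0%E.
    by move=> mA mB A0 B0; rewrite null_set_setU.
  have mC : measurable (~` `[0, 2 * pi]%classic : set (measurableTypeR R)).
    exact: measurableC.
  by apply: (U) => //; [do ?apply: measurableU|apply: (U) => //; [do ?apply: measurableU|exact: U]].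
- move=> t /= H; apply: contrapT => N; apply: H; split.
  + rewrite ltNge; apply/negP => h; apply: N.
    move: h; rewrite le_eqVlt => /orP[/eqP->|h]; first by left; left; right.
    by left; left; left; rewrite /= in_itv/= => /andP[]; rewrite leNgt h.
  + rewrite ltNge; apply/negP => h; apply: N.
    move: h; rewrite le_eqVlt => /orP[/eqP->|h]; first by left; right.
    by left; left; left; rewrite /= in_itv/= => /andP[_]; rewrite leNgt h.
  + by apply/eqP => h; apply: N; right.
Qed.

(* On [0, 2 pi], [tilt x] crosses [1/2] only at [x] and at the endpoints. *)
Definition tilt x t : R := (2 + (cos (x / 2) - cos (t - x / 2))) / 4.

(** Product-to-sum formula. On the open interval from [0] to [2 * pi] the factor [sin (t / 2)] is
    positive, so the sign of [sin ((t - x) / 2)] decides on which side of [1/2] the value lies. *)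
Lemma tiltE x t : tilt x t = 2^-1 + sin (t / 2) * sin ((t - x) / 2) / 2.
Proof.
rewrite /tilt; have -> : x / 2 = t / 2 - (t - x) / 2 by field.
have -> : t - (t / 2 - (t - x) / 2) = t / 2 + (t - x) / 2 by field.
by rewrite cosB cosD; field.
Qed.

Lemma tilt_itv x t : 0 <= tilt x t <= 1.
Proof.
have := cos_max (x / 2); have := cos_max (t - x / 2).
by rewrite !ler_norml /tilt; lra.
Qed.

Lemma tilt_lt x t : 0 < t < x -> x < 2 * pi -> 0 <= tilt x t < 2^-1.
Proof.
move=> /andP[t0 tx] x2; have /andP[-> _] := tilt_itv x t => /=.
rewrite tiltE -[ltRHS]addr0 ltrD2l pmulr_llt0 ?invr_gt0// pmulr_rlt0; last first.
  by apply: sin_gt0_pi; have := @pi_gt0 R; lra.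
have -> : (t - x) / 2 = - ((x - t) / 2) by field.
by rewrite sinN oppr_lt0 sin_gt0_pi//; lra.
Qed.

Lemma tilt_gt x t : 0 < x < t -> t < 2 * pi -> 2^-1 < tilt x t <= 1.
Proof.
move=> /andP[x0 xt] t2; have /andP[_ ->] := tilt_itv x t; rewrite andbT.
rewrite tiltE ltrDl !mulr_gt0 ?invr_gt0//; by apply: sin_gt0_pi; lra.
Qed.

Lemma trigpoly_tilt x : trigpoly (fun t => (tilt x t)%:C%C).
Proof.
(* [cos (t - x / 2)] is half the sum of [expi t * expi (- x / 2)] and its conjugate; with the
   quarter in [tilt] this produces the eighths. *)
have -> : (fun t => (tilt x t)%:C%C) = (fun t : R =>
   (cst ((2 + cos (x / 2)) / 4)%:C%C t +
    cst (Complex (- cos (x / 2) / 8) (sin (x / 2) / 8)) t * cexp 1 t) +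
    cst (Complex (- cos (x / 2) / 8) (- sin (x / 2) / 8)) t * cexp (-1) t : C_[R]).
  apply/funext => t; apply: complex_ext; rewrite ?RecD ?ImcD ?RecM ?ImcM/=.
    by rewrite mulN1r !mul1r cosN sinN /tilt cosB; field.
  by rewrite mulN1r !mul1r cosN sinN; field.
apply: trigpolyD; first apply: trigpolyD; try exact: trigpoly_cst;
  apply: trigpolyM; try exact: trigpoly_cst.
- exact: trigpoly_cexp1.
- exact: trigpoly_cexpN1.
Qed.

Lemma trigpoly_steep x n : trigpoly (fun t => (1 - steep (tilt x t) n)%:C%C).
Proof.
have tB (T : circle_fun R) : trigpoly T -> trigpoly (fun t => 1 - T t).
  move=> hT; have := trigpolyD (trigpoly_cst 1) (trigpolyM (trigpoly_cst (-1)) hT).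
  by under eq_fun do rewrite /= mulN1r.
have -> : (fun t => (1 - steep (tilt x t) n)%:C%C) = (fun t : R =>
    1 - (1 - ((tilt x t)%:C%C : C_[R]) ^+ n) ^+ (2 ^ n)).
  by apply/funext => t; rewrite rmorphB rmorph1 rmorphXn rmorphB rmorph1 rmorphXn.
apply: (tB (fun t => (1 - ((tilt x t)%:C%C : C_[R]) ^+ n) ^+ (2 ^ n))).
apply: (@trigpolyX R (fun t => (1 - ((tilt x t)%:C%C : C_[R]) ^+ n))).
apply: (tB (fun t => ((tilt x t)%:C%C : C_[R]) ^+ n)).
exact/trigpolyX/trigpoly_tilt.
Qed.

Lemma approximable_real_dominated (F : nat -> R -> R) (x : R -> R) (G : R -> R) :
  measurable_fun [set: measurableTypeR R] x ->
  (forall n, approximable (fun t => (F n t)%:C%C)) ->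
  mu.-integrable setT (fun t => (G t)%:E) ->
  {ae mu, forall t : measurableTypeR R, forall n, F n t ^+ 2 <= G t} ->
  {ae mu, forall t : measurableTypeR R, x t ^+ 2 <= G t} ->
  {ae mu, forall t : measurableTypeR R, F n t @[n --> \oo] --> x t} ->
  approximable (fun t => (x t)%:C%C).
Proof.
move=> mx aF iG FG xG Fx.
apply: (@approximable_dominated _ (fun n t => (F n t)%:C%C) _ G) => //.
- by apply: filterS FG => t h n; rewrite sqnorm_real.
- by apply: filterS xG => t h; rewrite sqnorm_real.
- apply: filterS Fx => t h.
  have -> : (fun n => sqnorm ((x t)%:C%C - (F n t)%:C%C : C_[R])) =
            (fun n => (x t - F n t) ^+ 2).
    by apply/funext => n; rewrite -rmorphB sqnorm_real.
  rewrite -[X in _ --> X](_ : (x t - x t) ^+ 2 = 0); last by rewrite subrr expr0n.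
  by rewrite expr2; apply: cvgM; apply: cvgB => //; exact: cvg_cst.
Qed.

Let integrable_cst (M : R) : mu.-integrable setT (fun t => M%:E).
Proof. exact: finite_measure_integrable_cst. Qed.

Lemma indic_sqr_le1 (A : set R) t : (\1_A t : R) ^+ 2 <= 1.
Proof. by rewrite indicE; case: (_ \in _); rewrite ?expr1n// expr0n. Qed.

(** For [0 < x < 2 * pi], the trigonometric polynomials [1 - steep (tilt x t) n] stay in [[0, 1]]
    and converge to the indicator at almost every [t]. For any other [x] the indicator is almost
    everywhere constant. *)
Lemma approximable_ray x : approximable (fun t => (\1_(`]x, +oo[%classic) t : R)%:C%C).
Proof.
have mi : measurable_fun [set: measurableTypeR R] (\1_(`]x, +oo[%classic) : R -> R).
  by apply: measurable_indic.
have cstcase (c : R) : {ae mu, forall t : measurableTypeR R, \1_(`]x, +oo[%classic) t = c} ->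
    approximable (fun t => (\1_(`]x, +oo[%classic) t : R)%:C%C).
  move=> h; apply: (@approximable_real_dominated (fun _ => cst c) _ (cst (c ^+ 2))) => //.
  - by move=> _; apply: approximable_trigpoly; exact: (trigpoly_cst c%:C%C).
  - exact: (integrable_cst (c ^+ 2)).
  - exact: aeW.
  - by apply: filterS h => t ->.
  - by apply: filterS h => t ->; exact: cvg_cst.
have [x0|x0] := leP x 0.
  apply: (cstcase 1); apply: filterS (ae_arclength_oo 0) => t [t0 _ _].
  by rewrite indicE mem_set// /= in_itv/= andbT (le_lt_trans x0).
have [x2|x2] := leP (2 * pi) x.
  apply: (cstcase 0); apply: filterS (ae_arclength_oo 0) => t [_ t2 _].
  rewrite indicE memNset// /= in_itv/= andbT => xt.
  by have := lt_trans (lt_le_trans t2 x2) xt; rewrite ltxx.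
apply: (@approximable_real_dominated
  (fun n t => 1 - steep (tilt x t) n) _ (cst 1)) => //.
- by move=> n; apply: approximable_trigpoly; exact: trigpoly_steep.
- exact: (integrable_cst 1).
- apply: aeW => t n; have := steep_itv n (tilt_itv x t) => /andP[h1 h2].
  by rewrite exprn_ile1//; lra.
- by apply: aeW => t; exact: indic_sqr_le1.
- apply: filterS (ae_arclength_oo x) => t [t0 t2 tx].
  have [h|h|h] := ltgtP t x; last by rewrite h eqxx in tx.
    rewrite indicE memNset//=; last by rewrite in_itv/= andbT => /(lt_trans h); rewrite ltxx.
    rewrite -[X in _ --> X](subrr (1 : R)); apply: cvgB; first exact: cvg_cst.
    by apply: steep_cvg1; apply: tilt_lt => //; rewrite t0.
  rewrite indicE mem_set//= ?in_itv/= ?andbT//.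
  rewrite -[X in _ --> X](subr0 (1 : R)); apply: cvgB; first exact: cvg_cst.
  by apply: steep_cvg0; apply: tilt_gt => //; rewrite x0.
Qed.

(** Rays are stable under intersection and generate the Borel sets, so Dynkin induction leaves
    complements and countable disjoint unions to check. *)
Lemma approximable_indic (A : set (measurableTypeR R)) : measurable A ->
  approximable (fun t => (\1_A t : R)%:C%C).
Proof.
have mE : @measurable _ (measurableTypeR R) = <<s @RGenOInfty.G R >>.
  exact: RGenOInfty.measurableE.
rewrite mE; apply: (@dynkin_induction _ (measurableTypeR R) (@RGenOInfty.G R)
  (fun A => approximable (fun t => (\1_A t : R)%:C%C))) => //.
- move=> _ _ [x ->] [y ->]; exists (Num.max x y).
  apply/seteqP; split => t /=; rewrite !in_itv/= !andbT gt_max; first by move=> [-> ->].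
  by move=> /andP[].
- have := approximable_trigpoly (trigpoly_cst (1 : C_[R])).
  by congr approximable; apply/funext => t; rewrite indicT.
- by move=> _ [x ->]; exact: approximable_ray.
- move=> A' _ aA; have := approximableD (approximable_trigpoly (trigpoly_cst (1 : C_[R])))
    (approximableZ (-1) aA).
  congr approximable; apply/funext => t /=.
  by rewrite mulN1r !indicE in_setC; case: (_ \in _); rewrite /= ?subrr ?subr0.
- move=> F mF tF aF.
  (* Finite partial unions: by disjointness their indicators are sums of indicators, and they
     converge boundedly to the indicator of the whole union. *)
  pose U n := \big[setU/set0]_(i < n) F i.
  have aU n : approximable (fun t => (\1_(U n) t : R)%:C%C).
    elim: n => [|n IH].
      have := approximable_trigpoly (trigpoly_cst (0 : C_[R])).
      by congr approximable; apply/funext => t; rewrite /U big_ord0 indic0.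
    have := approximableD IH (aF n); congr approximable; apply/funext => t.
    rewrite /U big_ord_recr/= -rmorphD -/(U n); congr (_%:C)%C.
    have UF : U n t -> F n t -> False.
      rewrite /U -bigcup_mkord => -[k /= kn Fkt] Fnt.
      have := tF k n I I; case: (eqVneq k n) => [kE|_ h]; first by rewrite kE ltnn in kn.
      by have : k = n by [apply: h; exists t]; move=> kE; rewrite kE ltnn in kn.
    rewrite !indicE; have [tU|tU] := boolP (t \in U n).
      rewrite memNset ?addr0; last by move=> Fnt; apply: UF => //; exact/set_mem.
      by rewrite mem_set//; left; exact/set_mem.
    have [tFn|tFn] := boolP (t \in F n).
      by rewrite add0r mem_set//; right; exact/set_mem.
    rewrite addr0 memNset//; case; first by move/mem_set; apply/negP.
    by move/mem_set; apply/negP.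
  apply: (@approximable_real_dominated (fun n t => \1_(U n) t) _ (cst 1)) => //.
  + by apply: measurable_indic; exact: bigcupT_measurable.
  + exact: (integrable_cst 1).
  + by apply: aeW => t n; exact: indic_sqr_le1.
  + by apply: aeW => t; exact: indic_sqr_le1.
  + apply: aeW => t; have [[k _ Fk]|N] := pselect ((\bigcup_k F k) t).
      apply: cvg_near_cst; exists k.+1 => // n /= kn.
      rewrite !indicE mem_set; last by rewrite /U -bigcup_mkord; exists k.
      by rewrite mem_set//; exists k.
    apply: cvg_near_cst; apply: nearW => n; rewrite !indicE memNset ?memNset//.
    by rewrite /U -bigcup_mkord => -[k _ Fk]; apply: N; exists k.
Qed.

Import HBNNSimple.

(** Simple functions increasing to [x] are finite combinations of indicators, and their squares are
    dominated by the integrable [x ^+ 2]. *)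
Lemma approximable_real_ge0 (x : R -> R) :
  (forall t, 0 <= x t) -> L2 (fun t => (x t)%:C%C) ->
  approximable (fun t => (x t)%:C%C).
Proof.
move=> x0 lx; have [mx _] := L2_cmeasurable lx.
have mEx : measurable_fun [set: measurableTypeR R] (EFin \o x) by exact/measurable_EFinP.
pose s := nnsfun_approx measurableT mEx.
have cs t : s^~ t @ \oo --> x t.
  suff: (EFin \o s^~ t) @ \oo --> (x t)%:E by move/fine_cvgP => [].
  by apply: cvg_nnsfun_approx => // u _; rewrite lee_fin.
have sx n t : s n t <= x t.
  rewrite -(cvg_lim _ (cs t))//; apply: nondecreasing_cvgn_le.
    by move=> k m km; have /lefP := nd_nnsfun_approx measurableT mEx km; exact.
  by apply/cvg_ex; exists (x t).
apply: (@approximable_real_dominated (fun n t => s n t) x (fun t => x t ^+ 2)) => //.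
- move=> n.
  have -> : (fun t => (s n t)%:C%C) =
     (fun t => \sum_(y <- fset_set (range (s n))) y%:C%C *
        (\1_(s n @^-1` [set y]) t : R)%:C%C : C_[R]).
    apply/funext => t; rewrite fimfunE fsbig_finite//= rmorph_sum/=.
    by apply: eq_bigr => y _; rewrite rmorphM.
  apply: approximable_sum => y; apply: approximableZ; apply: approximable_indic.
  exact: measurable_sfunP.
- by have := integrable_sqnorm lx; under eq_fun do rewrite sqnorm_real.
- apply: aeW => t n; rewrite ler_sqr ?nnegrE//; exact: fun_ge0.
- exact: aeW.
- exact: aeW.
Qed.

(** Decomposition into real and imaginary parts, and of each into positive and negative parts, which
    inherit square integrability. *)
Lemma L2_approximable f : L2 f -> approximable f.
Proof.
have real (x : R -> R) : L2 (fun t => (x t)%:C%C) -> approximable (fun t => (x t)%:C%C).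
  move=> lx; have [mx _] := L2_cmeasurable lx.
  have isx := integrable_sqnorm lx.
  have part (y : R -> R) : measurable_fun [set: measurableTypeR R] y ->
      (forall t, 0 <= y t <= `|x t|) -> approximable (fun t => (y t)%:C%C).
    move=> my yx; apply: approximable_real_ge0; first by move=> t; have /andP[] := yx t.
    apply: (L2_le (cmeasurable_real my) isx); apply: aeW => t; rewrite !sqnorm_real.
    have /andP[y0 yx'] := yx t.
    by rewrite -[leRHS]real_normK ?num_real// ler_sqr ?nnegrE.
  have aP : approximable (fun t => (Num.max (x t) 0)%:C%C).
    apply: part; first exact: measurable_maxr.
    by move=> t; rewrite le_max lexx orbT ge_max normr_ge0 ler_norm.
  have aN : approximable (fun t => (Num.max (- x t) 0)%:C%C).
    apply: part; first by apply: measurable_maxr => //; exact: measurableT_comp.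
    by move=> t; rewrite le_max lexx orbT ge_max normr_ge0 -normrN ler_norm.
  have := approximableD aP (approximableZ (-1) aN).
  congr approximable; apply/funext => t; rewrite mulN1r -rmorphB; congr (_%:C)%C.
  by have [h|h] := leP (x t) 0; have [h'|h'] := leP (- x t) 0; lra.
move=> lf; have [m1 m2] := L2_cmeasurable lf.
have isf := integrable_sqnorm lf.
have a1 : approximable (fun t => (Re (f t))%:C%C).
  apply: real; apply: (L2_le (cmeasurable_real m1) isf).
  by apply: aeW => t; rewrite sqnorm_real lerDl sqr_ge0.
have a2 : approximable (fun t => (Im (f t))%:C%C).
  apply: real; apply: (L2_le (cmeasurable_real m2) isf).
  by apply: aeW => t; rewrite sqnorm_real lerDr sqr_ge0.
have := approximableD a1 (approximableZ (Complex 0 1) a2).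
congr approximable; apply/funext => t.
by apply: complex_ext; rewrite ?RecD ?ImcD ?RecM ?ImcM/=; ring.
Qed.

End DensityL2.

(** * Fourier coefficients and products of L^2 functions *)

Section Fourier.
Context {R : realType}.
Implicit Types (f g h u v p q T : circle_fun R) (z w : C_[R]).
Local Notation mu := (@arclength R).
Local Notation Re := complex.Re.
Local Notation Im := complex.Im.

Lemma cintegrable_inner f g : L2 f -> L2 g -> cintegrable (fun t => f t * (g t)^*).
Proof. by move=> lf lg; apply: cintegrableM => //; exact: L2_conj. Qed.

Lemma innerC f g : L2 f -> L2 g -> inner g f = (inner f g)^*.
Proof.
move=> lf lg; rewrite /inner -cintegral_conj; last exact: cintegrable_inner.
by congr cintegral; apply/funext => t; rewrite rmorphM/= conjCK mulrC.
Qed.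

Lemma innerBl f g h : L2 f -> L2 g -> L2 h ->
  inner (fun t => f t - g t) h = inner f h - inner g h.
Proof.
move=> lf lg lh; rewrite /inner -cintegralB; try exact: cintegrable_inner.
by congr cintegral; apply/funext => t; rewrite mulrBl.
Qed.

Lemma inner_suml (I : Type) (s : seq I) (c : I -> C_[R]) (F : I -> circle_fun R) g :
  (forall i, L2 (F i)) -> L2 g ->
  inner (fun t => \sum_(i <- s) c i * F i t) g = \sum_(i <- s) c i * inner (F i) g.
Proof.
move=> lF lg; rewrite /inner.
transitivity (cintegral (fun t => \sum_(i <- s) c i * (F i t * (g t)^*))).
  by congr cintegral; apply/funext => t; rewrite mulr_suml; apply: eq_bigr => i _; rewrite mulrA.
rewrite cintegral_sum => [|i]; last exact/cintegrableZ/cintegrable_inner.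
by apply: eq_bigr => i _; rewrite cintegralZ//; exact: cintegrable_inner.
Qed.

Lemma inner_sumr (I : Type) (s : seq I) (c : I -> C_[R]) (F : I -> circle_fun R) g :
  (forall i, L2 (F i)) -> L2 g ->
  inner g (fun t => \sum_(i <- s) c i * F i t) = \sum_(i <- s) (c i)^* * inner g (F i).
Proof.
move=> lF lg; rewrite innerC//; last by apply: L2_sum => i; exact: L2Z.
rewrite inner_suml// rmorph_sum; apply: eq_bigr => i _.
by rewrite rmorphM/= -innerC.
Qed.

Lemma inner_cexp (m n : int) : inner (cexp m) (cexp n) = (m == n)%:R :> C_[R].
Proof.
rewrite /inner -subr_eq0 -cintegral_cexp; congr cintegral; apply/funext => t.
by rewrite -cexpN -cexpD.
Qed.

Lemma energyD f g : L2 f -> L2 g ->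
  fine (energy (fun t => f t + g t)) =
  fine (energy f) + fine (energy g) + 2 * Re (inner f g).
Proof.
move=> lf lg; have if_ := integrable_sqnorm lf; have ig := integrable_sqnorm lg.
have [i1 _] := cintegrable_inner lf lg.
have i2 : mu.-integrable setT (fun t => (2 * Re (f t * (g t)^*))%:E).
  by under eq_fun do rewrite EFinM; exact: integrableZl.
have i3 : mu.-integrable setT (fun t => (sqnorm (f t) + sqnorm (g t))%:E).
  exact: (integrableD measurableT if_ ig).
rewrite [Re _]/= -RintegralZl// -[RHS]/(Rintegral mu setT (fun t => sqnorm (f t)) +
  Rintegral mu setT (fun t => sqnorm (g t)) + _) -RintegralD// -RintegralD//.
by apply: eq_Rintegral => t _; rewrite /sqnorm !ReImE; ring.
Qed.

Lemma energy_inner f : L2 f -> inner f f = (fine (energy f))%:C%C.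
Proof.
move=> lf; rewrite /inner; under eq_fun do rewrite sqnormE.
by apply: complex_ext => //=; rewrite Rintegral_cst// mul0r.
Qed.

Lemma energy_eq0 f : L2 f -> inner f f = 0 -> ae_eq_circle f (cst 0).
Proof.
move=> lf; rewrite energy_inner// => -[] E0.
have /integrableP[mE _] := integrable_sqnorm lf.
have : (\int[mu]_t `|(sqnorm (f t))%:E| = 0)%E.
  under eq_integral do rewrite gee0_abs ?lee_fin ?sqnorm_ge0//.
  rewrite -[LHS]fineK; first by congr EFin; exact: E0.
  by rewrite ge0_fin_numE ?energy_ge0//; have /L2P[] := lf.
move/(ae_eq_integral_abs mu measurableT mE) => h.
by apply: filterS h => t /= /(_ I) [] /sqnorm_eq0.
Qed.

Definition fourier f (n : int) := inner f (cexp n).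

(** Pythagoras: the error of the Fourier sum is orthogonal to every character in it, hence to its
    difference [D] from a competitor. Any close trigonometric polynomial can therefore be replaced
    by the Fourier sum over the same frequencies. *)
Lemma best_approximation p (m N : nat) (c : nat -> C_[R]) : L2 p ->
  fine (energy (fun t => p t -
     \sum_(i < m) fourier p (i%:Z - N%:Z) * cexp (i%:Z - N%:Z) t)) <=
  fine (energy (fun t => p t - \sum_(i < m) c i * cexp (i%:Z - N%:Z) t)).
Proof.
move=> lp.
have lS (d : nat -> C_[R]) : L2 (fun t => \sum_(i < m) d i * cexp (i%:Z - N%:Z) t).
  by apply: L2_sum => i; exact/L2Z/L2_cexp.
pose a i := fourier p (i%:Z - N%:Z).
pose S t := \sum_(i < m) a i * cexp (i%:Z - N%:Z) t.
pose D t := \sum_(i < m) (a i - c i) * cexp (i%:Z - N%:Z) t.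
have -> : (fun t => p t - \sum_(i < m) c i * cexp (i%:Z - N%:Z) t) =
          (fun t => (p t - S t) + D t).
  apply/funext => t; rewrite /D; under [in RHS]eq_bigr do rewrite mulrBl.
  by rewrite sumrB addrA subrK.
have lpS : L2 (fun t => p t - S t) by apply: L2B => //; exact: lS.
have lD : L2 D by exact: (lS (fun i => a i - c i)).
rewrite (@energyD (fun t => p t - S t) D)//.
suff -> : inner (fun t => p t - S t) D = 0.
  by rewrite mulr0 addr0 lerDl fine_ge0// energy_ge0.
rewrite inner_sumr => [|i|]; [|exact: L2_cexp|exact: lpS].
rewrite big1// => i _; rewrite innerBl//; [|exact: lS|exact: L2_cexp].
rewrite inner_suml => [|j|]; [|exact: L2_cexp|exact: L2_cexp].
rewrite (bigD1 i)//= inner_cexp eqxx mulr1 big1 ?addr0 ?subrr ?mulr0// => j ji.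
rewrite inner_cexp; case: eqP => [/addIr [] /val_inj jiE|_]; last by rewrite mulr0.
by rewrite jiE eqxx in ji.
Qed.

(** The sign flips because the product is integrated without conjugation. *)
Lemma cintegral_cexpr u (k : int) : cintegral (fun t => u t * cexp k t) = fourier u (- k).
Proof. by congr cintegral; apply/funext => t; rewrite -cexpN opprK. Qed.

(** Parseval: formally the integral is the sum over [k] of [fourier u (- k) * fourier p k]. All
    terms vanish for the Fourier sums of [p], some of which are arbitrarily close to [p], and
    [cintegralM_eq0] passes to the limit. *)
Lemma cintegralM_spectra u p : L2 u -> L2 p ->
  (forall k, fourier u (- k) = 0 \/ fourier p k = 0) ->
  cintegral (fun t => u t * p t) = 0.
Proof.
move=> lu lp H; apply: cintegralM_eq0 => // e e0.
have [_ /(_ _ e0)[T [hT pT]]] := L2_approximable lp.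
have [N [m [c TE]]] := trigpoly_sum hT.
exists (fun t => \sum_(i < m) fourier p (i%:Z - N%:Z) * cexp (i%:Z - N%:Z) t); split.
- by apply: L2_sum => i; exact/L2Z/L2_cexp.
- by apply: le_lt_trans pT; rewrite TE; exact: best_approximation.
- transitivity (cintegral (fun t => \sum_(i < m) fourier p (i%:Z - N%:Z) *
    (u t * cexp (i%:Z - N%:Z) t))).
    congr cintegral; apply/funext => t; rewrite mulr_sumr.
    by apply: eq_bigr => i _; rewrite mulrCA.
  have ci i : cintegrable (fun t => u t * cexp (i%:Z - N%:Z) t).
    by apply: cintegrableM => //; exact: L2_cexp.
  rewrite (@cintegral_sum _ _ _ (fun i : 'I_m => _)) => [|i]; last exact: cintegrableZ.
  rewrite big1// => i _; rewrite cintegralZ// cintegral_cexpr.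
  by case: (H (i%:Z - N%:Z)) => ->; rewrite ?mulr0 ?mul0r.
Qed.

(** Completeness of the characters: Parseval for [f] and its conjugate shows that the energy of [f]
    is zero. *)
Lemma fourier_eq0 f : L2 f -> (forall n, fourier f n = 0) -> ae_eq_circle f (cst 0).
Proof.
move=> lf H; apply: energy_eq0 => //; apply: cintegralM_spectra => //.
  exact: L2_conj.
by move=> k; left; exact: H.
Qed.

Lemma fourier_cexpM f (n k : int) : fourier (fun t => cexp n t * f t) k = fourier f (k - n).
Proof.
congr cintegral; apply/funext => t.
by rewrite -!cexpN opprB cexpD; ring.
Qed.

(** If [i] and [j] were the least indices of nonzero entries, the Cauchy product at [i + j] would
    reduce to the single nonzero term [c i * d j]. *)
Lemma convolution_eq0 (c d : nat -> C_[R]) :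
  (forall n, \sum_(k < n.+1) c k * d (n - k)%N = 0) ->
  (forall n, c n = 0) \/ (forall n, d n = 0).
Proof.
move=> H.
have [hc|/existsNP[i0 /eqP hi0]] := pselect (forall n, c n = 0); first by left.
have [hd|/existsNP[j0 /eqP hj0]] := pselect (forall n, d n = 0); first by right.
exfalso.
case: (@ex_minnP (fun i => c i != 0) (ex_intro _ i0 hi0)) => i ci mi.
case: (@ex_minnP (fun j => d j != 0) (ex_intro _ j0 hj0)) => j dj mj.
have ltij : (i < (i + j).+1)%N by rewrite ltnS leq_addr.
have := H (i + j)%N; rewrite (bigD1 (Ordinal ltij))//= addKn big1 ?addr0.
  by move/eqP; rewrite mulf_eq0 (negbTE ci) (negbTE dj).
move=> k ki; have [kli|ilk|E] := ltngtP k i.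
- have [->|/mi] := eqVneq (c k) 0; first by rewrite mul0r.
  by rewrite leqNgt kli.
- have [->|/mj] := eqVneq (d (i + j - k)%N) 0; first by rewrite mulr0.
  by have := ltn_ord k; lia.
- by case/eqP: ki; exact: val_inj.
Qed.

(** For [n >= 0] the coefficient of [u * p] at [n] is a finite Cauchy product, and it equals that of
    [v * q], which is zero; [convolution_eq0] then applies. *)
Lemma analytic_product u p v q : L2 u -> L2 p -> L2 v -> L2 q ->
  (forall n : int, n < 0 -> fourier u n = 0) ->
  (forall n : int, n < 0 -> fourier p n = 0) ->
  (forall n : int, 0 < n -> fourier v n = 0) ->
  (forall n : int, 0 <= n -> fourier q n = 0) ->
  ae_eq_circle (fun t => u t * p t) (fun t => v t * q t) ->
  ae_eq_circle u (cst 0) \/ ae_eq_circle p (cst 0).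
Proof.
move=> lu lp lv lq hu hp hv hq E.
have key (n : nat) : \sum_(k < n.+1) fourier p k * fourier u (n - k)%N = 0.
  (* [P] is [p] without its frequencies [0] to [n], the only ones that can contribute to the
     coefficient of [u * p] at [n]. *)
  pose P t := p t - \sum_(k < n.+1) fourier p (k%:Z - 0%:Z) * cexp (k%:Z - 0%:Z) t.
  have lS : L2 (fun t => \sum_(k < n.+1) fourier p (k%:Z - 0%:Z) * cexp (k%:Z - 0%:Z) t).
    by apply: L2_sum => i; exact/L2Z/L2_cexp.
  have lP : L2 P by exact: L2B.
  have lw (f : circle_fun R) : L2 f -> L2 (fun t => cexp (- n%:Z) t * f t).
    exact: L2_cexpM.
  (* The frequencies of [v] are at most [0] and those of [q] are negative, so none of their sums
     equals [n]. *)
  have zv : cintegral (fun t => (cexp (- n%:Z) t * v t) * q t) = 0.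
    apply: cintegralM_spectra => //; first exact: lw.
    move=> k; rewrite fourier_cexpM; have [k0|k0] := ltP k 0.
      by left; apply: hv; lia.
    by right; exact: hq.
  (* [fourier u (n - k)] vanishes for [k > n], while [P] has no frequency [k <= n]. *)
  have zP : cintegral (fun t => (cexp (- n%:Z) t * u t) * P t) = 0.
    apply: cintegralM_spectra => //; first exact: lw.
    move=> k; rewrite fourier_cexpM; have [kn|kn] := ltP n%:Z k.
      by left; apply: hu; lia.
    right; rewrite /fourier innerBl//; last exact: L2_cexp.
    rewrite inner_suml => [|j|]; [|exact: L2_cexp|exact: L2_cexp].
    case: k kn => k kn; last first.
      rewrite -/(fourier _ _) hp// sub0r big1 ?oppr0// => i _.
      by rewrite inner_cexp; case: eqP => // _; rewrite mulr0.
    have kn' : (k < n.+1)%N by lia.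
    rewrite (bigD1 (Ordinal kn'))//= inner_cexp subr0 eqxx mulr1 big1 ?addr0 ?subrr//.
    move=> i ik; rewrite inner_cexp subr0; case: eqP => [[] ikE|_]; last by rewrite mulr0.
    by case/eqP: ik; exact: val_inj.
  have zu : cintegral (fun t => (cexp (- n%:Z) t * u t) * p t) = 0.
    rewrite -zv; apply: ae_eq_cintegral.
    - by apply: cmeasurableM; apply: L2_cmeasurable => //; exact: lw.
    - by apply: cmeasurableM; apply: L2_cmeasurable => //; exact: lw.
    - by apply: filterS E => t /= E; rewrite -!mulrA E.
  (* [p - P] is a finite Fourier sum, so this integral can be expanded term by term into the Cauchy
     product. *)
  have : cintegral (fun t => (cexp (- n%:Z) t * u t) * (p t - P t)) = 0.
    transitivity (cintegral (fun t => (cexp (- n%:Z) t * u t) * p t) -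
                  cintegral (fun t => (cexp (- n%:Z) t * u t) * P t)); last first.
      by rewrite zu zP subrr.
    rewrite -cintegralB; try by apply: cintegrableM => //; exact: lw.
    by congr cintegral; apply/funext => t; rewrite mulrBr.
  move=> h0; rewrite -[RHS]h0.
  transitivity (cintegral (fun t => \sum_(k < n.+1) fourier p k *
     ((cexp (- n%:Z) t * u t) * cexp k t))); last first.
    congr cintegral; apply/funext => t; rewrite /P subKr mulr_sumr.
    by apply: eq_bigr => k _; rewrite subr0 mulrCA.
  have ci (k : int) : cintegrable (fun t => (cexp (- n%:Z) t * u t) * cexp k t).
    by apply: cintegrableM; [exact: lw|exact: L2_cexp].
  rewrite (@cintegral_sum _ _ _ (fun i : 'I_n.+1 => _)) => [|i]; last first.
    exact: cintegrableZ.
  apply: eq_bigr => k _; rewrite cintegralZ// cintegral_cexpr fourier_cexpM.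
  congr (_ * fourier _ _).
  by have := ltn_ord k; lia.
have [h|h] := @convolution_eq0 (fun k => fourier p k) (fun k => fourier u k) key; [right|left]; apply: fourier_eq0 => // -[n|n].
- exact: h.
- exact: hp.
- exact: h.
- exact: hu.
Qed.

End Fourier.

(** * Boundary values in the Hardy space and their spectra *)

Section Hardy.
Context {R : realType}.
Implicit Types (f g h : circle_fun R) (z w : C_[R]) (n N M : nat).
Local Notation mu := (@arclength R).
Local Notation Re := complex.Re.
Local Notation Im := complex.Im.
Local Notation normc := Normc.normc.

Lemma normE z : `|z| = (normc z)%:C%C. Proof. by case: z. Qed.

Lemma Re_le_normc z : `|Re z| <= normc z.
Proof.
rewrite -ler_sqr ?nnegrE ?sqrtr_ge0//; last by case: z => a b; exact: sqrtr_ge0.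
by rewrite real_normK ?num_real// -sqnorm_normc lerDl sqr_ge0.
Qed.

Lemma Im_le_normc z : `|Im z| <= normc z.
Proof.
rewrite -ler_sqr ?nnegrE ?sqrtr_ge0//; last by case: z => a b; exact: sqrtr_ge0.
by rewrite real_normK ?num_real// -sqnorm_normc lerDr sqr_ge0.
Qed.

Lemma cvg_ReIm (T : Type) (F : set_system T) {FF : Filter F} (x : T -> C_[R]) z :
  x @ F --> z ->
  (fun t => Re (x t) : R) @ F --> (Re z : R) /\ (fun t => Im (x t) : R) @ F --> (Im z : R).
Proof.
move=> xz; split; apply/cvgrPdist_lt => e e0.
- have e0' : 0 < e%:C%C :> C_[R] by rewrite ltcR.
  move/cvgrPdist_lt : xz => /(_ _ e0'); apply: filterS => t.
  rewrite normE ltcR; apply: le_lt_trans.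
  by have := Re_le_normc (z - x t); rewrite RecD RecN.
- have e0' : 0 < e%:C%C :> C_[R] by rewrite ltcR.
  move/cvgrPdist_lt : xz => /(_ _ e0'); apply: filterS => t.
  rewrite normE ltcR; apply: le_lt_trans.
  by have := Im_le_normc (z - x t); rewrite ImcD ImcN.
Qed.

Lemma cvg_sqnormB (T : Type) (F : set_system T) {FF : Filter F} (x : T -> C_[R]) z w :
  (fun t => Re (x t) : R) @ F --> (Re z : R) ->
  (fun t => Im (x t) : R) @ F --> (Im z : R) ->
  (fun t => sqnorm (x t - w)) @ F --> sqnorm (z - w).
Proof.
move=> h1 h2; rewrite /sqnorm; under eq_fun do rewrite RecD RecN ImcD ImcN.
by rewrite RecD RecN ImcD ImcN; apply: cvgD; rewrite expr2;
  under eq_fun do rewrite expr2; apply: cvgM; apply: cvgB => //; exact: cvg_cst.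
Qed.

Lemma cvg_scale_complex (T : Type) (F : set_system T) {FF : Filter F} (x : T -> R) z :
  x @ F --> (1 : R) -> (fun t => (x t)%:C%C * z : C_[R]) @ F --> z.
Proof.
move=> x1; apply/cvgrPdist_lt => e e0.
have eE : e = (Re e)%:C%C.
  by apply: complex_ext => //=; move: e0; rewrite ltcE /= => /andP[/eqP].
have re0 : 0 < Re e by move: e0; rewrite {1}eE ltcR.
have z0 : 0 < normc z + 1 by apply: ltr_wpDl => //; case: z => a b; exact: sqrtr_ge0.
move/cvgrPdist_lt : x1 => /(_ _ (divr_gt0 re0 z0)); apply: filterS => t h.
rewrite -{1}[z]mul1r -mulrBl normE eE ltcR Normc.normcM.
have -> : normc (1 - (x t)%:C%C : C_[R]) = `|1 - x t|.
  by rewrite -(rmorph1 (real_complex R)) -rmorphB /= expr0n/= addr0 sqrtr_sqr.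
move: h; rewrite ltr_pdivlMr// mulrDr mulr1; apply: le_lt_trans.
by rewrite lerDl.
Qed.

Lemma H2plus_cexp n : H2plus (cexp n : circle_fun R).
Proof.
have sE (z : C_[R]) (m : nat) : (n < m)%N ->
    series (fun k => (k == n)%:R * z ^+ k) m = z ^+ n.
  move=> nm; rewrite /series /= big_mkord (bigD1 (Ordinal nm))//= eqxx mul1r.
  by rewrite big1 ?addr0// => i; rewrite -val_eqE /= => /negbTE ->; rewrite mul0r.
split; first exact: L2_cexp; exists (fun z => z ^+ n).
- exists (fun k => (k == n)%:R).
    apply/cvg_ex; exists 1; apply: cvg_near_cst; exists n.+1 => // m /= nm.
    rewrite /series /= big_mkord (bigD1 (Ordinal nm))//= eqxx Normc.normc1 expr1n.
    rewrite big1 ?addr0// => i; rewrite -val_eqE /= => /negbTE ->.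
    by rewrite Normc.normc0 expr0n.
  by move=> z _; apply: cvg_near_cst; exists n.+1 => // m /= nm; exact: sE.
- apply: aeW => t; rewrite cexp_nat.
  under eq_fun do rewrite exprMn -rmorphXn.
  apply: cvg_scale_complex; apply: cvg_at_left_filter.
  by rewrite -[X in _ --> X](expr1n _ n); exact: exprn_continuous.
Qed.

(** Parseval for finite sums, from orthonormality of the characters. *)
Lemma energy_polynomial M (d : nat -> C_[R]) :
  energy (fun t => \sum_(i < M) d i * cexp i t) = (\sum_(i < M) sqnorm (d i))%:E.
Proof.
have lS : L2 (fun t => \sum_(i < M) d i * cexp i t).
  by apply: L2_sum => i; exact/L2Z/L2_cexp.
have E : (fine (energy (fun t => \sum_(i < M) d i * cexp i t)))%:C%C =
    (\sum_(i < M) sqnorm (d i))%:C%C :> C_[R].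
  rewrite -energy_inner// inner_suml//; last by move=> i; exact: L2_cexp.
  rewrite rmorph_sum; apply: eq_bigr => i _.
  rewrite inner_sumr => [|j|]; [|exact: L2_cexp|exact: L2_cexp].
  rewrite (bigD1 i)//= inner_cexp eqxx mulr1 big1 ?addr0 ?sqnormE// => j ji.
  rewrite inner_cexp; case: eqP => [[] ijE|_]; last by rewrite mulr0.
  by case/eqP: ji; apply: val_inj.
case: E => <-; rewrite fineK// ge0_fin_numE ?energy_ge0//.
by have /L2P[] := lS.
Qed.

(** Fatou's lemma: almost everywhere the limit inferior is the limit, and a bound valid from some
    index on also bounds the limit inferior of the energies. *)
Lemma energy_fatou (G : nat -> circle_fun R) g (B : R) :
  (forall n, cmeasurable (G n)) -> cmeasurable g ->
  {ae mu, forall t, (fun n => sqnorm (G n t)) @ \oo --> sqnorm (g t)} ->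
  (\forall n \near \oo, (energy (G n) <= B%:E)%E) -> (energy g <= B%:E)%E.
Proof.
move=> mG mg Gg GB.
have mGn n : measurable_fun [set: measurableTypeR R] (fun t => (sqnorm (G n t))%:E).
  by apply/measurable_EFinP; exact: cmeasurable_sqnorm.
have -> : energy g = (\int[mu]_t limn_einf (fun n => (sqnorm (G n t))%:E))%E.
  apply: ae_eq_integral => //.
  - by apply/measurable_EFinP; exact: cmeasurable_sqnorm.
  - rewrite /limn_einf; apply: measurableT_comp => //.
    apply: (@measurable_fun_limn_esup _ _ _ _ (fun n t => - (sqnorm (G n t))%:E)%E) => n.
    exact: measurableT_comp.
  - apply: filterS Gg => t h _.
    have cv : (fun n => (sqnorm (G n t))%:E) @ \oo --> (sqnorm (g t))%:E.
      by apply: cvg_EFin; [exact: nearW|exact: h].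
    by have [-> _] := cvg_limn_einf_sup cv.
apply: le_trans (fatou mu measurableT mGn _) _.
  by move=> n t _; rewrite lee_fin sqnorm_ge0.
rewrite limn_einf_lim; apply: lime_le; first exact: is_cvg_einfs.
apply: filterS GB => n; apply: le_trans.
by apply: ereal_inf_lbound; exists n => /=.
Qed.

(** The approximant is a Taylor polynomial [P] of [F]. It is compared by Parseval with [Q r M], a
    partial Taylor sum of [F] on the circle of radius [r]; Fatou's lemma is used first as [M] tends
    to infinity, then as [r] tends to [1]. *)
Lemma H2plus_approx f (e : R) : H2plus f -> 0 < e -> exists N (c : nat -> C_[R]),
  (energy (fun t => f t - \sum_(i < N) c i * cexp i t)%R <= e%:E)%E.
Proof.
move=> [lf [F [c cc cF] bF]] e0.
(* The tail of the convergent coefficient series, bounded uniformly in its upper end [M]; it takes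
   half of the tolerance. *)
have [N hN] : exists N, forall M, \sum_(N <= i < M) sqnorm (c i) <= e / 2.
  have nd : nondecreasing_seq (series (fun n => normc (c n) ^+ 2)).
    by apply: nondecreasing_series => i _ _; exact: sqr_ge0.
  move/cvg_ex : (cc) => [l lc].
  move/cvgrPdist_lt : (lc) => /(_ _ (divr_gt0 e0 (ltr0n _ 2)))[N _ /(_ N (leqnn N)) hN].
  exists N => M; have [MN|NM] := leqP M N.
    by rewrite big_geq// divr_ge0 ?ltW.
  have le : series (fun n => normc (c n) ^+ 2) M <= l.
    by rewrite -(cvg_lim _ lc)//; exact: nondecreasing_cvgn_le.
  have : \sum_(N <= i < M) sqnorm (c i) =
      series (fun n => normc (c n) ^+ 2) M - series (fun n => normc (c n) ^+ 2) N.
    rewrite sub_series_geq 1?ltnW//.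
    by apply: eq_bigr => i _; rewrite sqnorm_normc.
  by move: hN => /=; rewrite ltr_norml => /andP[_ h1] ->; move: le h1 => /=; lra.
exists N, c.
pose P t := \sum_(i < N) c i * cexp i t : C_[R].
pose K := \sum_(i < N) sqnorm (c i).
have K0 : 0 <= K by apply: sumr_ge0 => i _; exact: sqnorm_ge0.
pose Q (r : R) M t := \sum_(i < M) (c i * (r ^+ i)%:C%C) * cexp i t : C_[R].
have lP : L2 P by apply: L2_sum => i; exact/L2Z/L2_cexp.
have lQ r M : L2 (Q r M).
  by apply: L2_sum => i; exact/L2Z/L2_cexp.
have QF (r : R) t : 0 <= r < 1 -> Q r M t @[M --> \oo] --> F (r%:C%C * expi t).
  move=> /andP[r0 r1].
  have : normc (r%:C%C * expi t) < 1 :> R.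
    rewrite Normc.normcM /= cos2Dsin2 sqrtr1 mulr1 expr0n/= addr0 sqrtr_sqr.
    by rewrite ger0_norm.
  move/(cF (r%:C%C * expi t)).
  suff -> : (Q r)^~ t = series (fun n => c n * (r%:C%C * expi t) ^+ n) by [].
  apply/funext => M; rewrite /Q /series /= big_mkord; apply: eq_bigr => i _.
  by rewrite exprMn cexp_nat rmorphXn mulrA.
(* Below [N] each coefficient is off by a factor [1 - r ^+ i <= N * (1 - r)], by Bernoulli; from [N]
   on the tail bound applies. The first contribution vanishes as [r] tends to [1]. *)
have EQ (r : R) M : 0 <= r < 1 -> (N <= M)%N ->
    (energy (fun t => (Q r M t - P t)%R) <= ((N%:R * (1 - r)) ^+ 2 * K + e / 2)%:E)%E.
  move=> /andP[r0 r1] NM.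
  pose d i : C_[R] := c i * (r ^+ i - (i < N)%N%:R)%:C%C.
  have -> : (fun t => Q r M t - P t) = (fun t => \sum_(i < M) d i * cexp i t).
    apply/funext => t; rewrite /Q /P /d (big_ord_widen _ (fun i => c i * cexp i t) NM).
    rewrite [X in _ - X]big_mkcond/= -sumrB; apply: eq_bigr => i _.
    by rewrite rmorphB/=; case: ifP => _; rewrite ?rmorph1 ?rmorph0 ?subr0//; ring.
  rewrite energy_polynomial lee_fin -(big_mkord xpredT (fun i => sqnorm (d i))).
  rewrite (big_cat_nat (n := N))//=; apply: lerD.
    rewrite big_mkord /K mulr_sumr; apply: ler_sum => i _.
    rewrite /d sqnormM sqnorm_real mulrC ler_wpM2r ?sqnorm_ge0//.
    rewrite ltn_ord -sqrrN opprB.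
    have h1 : 0 <= 1 - r ^+ i by rewrite subr_ge0 exprn_ile1// ltW.
    have h2 : 1 - r ^+ i <= N%:R * (1 - r).
      have := @bernoulli_onem_ge R (1 - r) i; rewrite subKr => /(_ _).
      have iN : i%:R * (1 - r) <= N%:R * (1 - r).
        by apply: ler_wpM2r; [rewrite subr_ge0 ltW|rewrite ler_nat ltnW].
      have ri : 0 <= 1 - r <= 1 by rewrite subr_ge0 (ltW r1) gerBl.
      by move=> /(_ ri); move: iN; lra.
    by rewrite ler_sqr ?nnegrE// (le_trans h1).
  apply: le_trans (hN M); rewrite big_seq [leRHS]big_seq; apply: ler_sum => i.
  rewrite mem_index_iota => /andP[Ni _].
  rewrite /d sqnormM sqnorm_real ltnNge Ni/= subr0.
  by rewrite ler_piMr ?sqnorm_ge0// -exprM exprn_ile1// ltW.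
(* [F] is known only through its power series, so measurability on the circle of radius [r] comes
   from pointwise convergence of [Q r M]. *)
have mF (r : R) : 0 <= r < 1 -> cmeasurable (fun t => F (r%:C%C * expi t)).
  move=> r01; split.
  - apply: (@measurable_fun_cvg _ _ _ _ (fun M t => Re (Q r M t))).
      by move=> M; have [] := L2_cmeasurable (lQ r M).
    by move=> t _; have [] := cvg_ReIm (QF r t r01).
  - apply: (@measurable_fun_cvg _ _ _ _ (fun M t => Im (Q r M t))).
      by move=> M; have [] := L2_cmeasurable (lQ r M).
    by move=> t _; have [] := cvg_ReIm (QF r t r01).
have EF (r : R) : 0 <= r < 1 ->
    (energy (fun t => (F (r%:C%C * expi t) - P t)%R) <=
       ((N%:R * (1 - r)) ^+ 2 * K + e / 2)%:E)%E.
  move=> r01; apply: (@energy_fatou (fun M t => Q r M t - P t)).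
  - by move=> M; apply: cmeasurableB; exact: L2_cmeasurable.
  - by apply: cmeasurableB; [exact: mF|exact: L2_cmeasurable].
  - by apply: aeW => t; have [h1 h2] := cvg_ReIm (QF r t r01); exact: cvg_sqnormB.
  - by exists N => // M /= NM; exact: EQ.
(* Fatou's lemma works along a sequence, so the radial limit is sampled at these radii. *)
pose r k : R := 1 - k.+1%:R^-1.
have r01 k : 0 <= r k < 1.
  have h : 0 < k.+1%:R^-1 :> R by rewrite invr_gt0.
  have h' : k.+1%:R^-1 <= 1 :> R by rewrite invf_le1// ler1n.
  by rewrite /r subr_ge0 h' gtrBl.
have r1 : r k @[k --> \oo] --> (1 : R).
  rewrite -[X in _ --> X]subr0; apply: cvgB; first exact: cvg_cst.
  exact: cvg_harmonic.
apply: (@energy_fatou (fun k t => F ((r k)%:C%C * expi t) - P t)).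
- by move=> k; apply: cmeasurableB; [exact: mF|exact: L2_cmeasurable].
- by apply: cmeasurableB; exact: L2_cmeasurable.
- have bF' : {ae mu, forall t : measurableTypeR R,
      F (r%:C%C * expi t) @[r --> (1 : R)^'-] --> (f t : C_[R])} by exact: bF.
  apply: filterS bF' => t /cvg_ReIm[h1 h2]; apply: cvg_sqnormB.
  + move/cvg_at_leftP : h1; apply; split=> // k; by have /andP[] := r01 k.
  + move/cvg_at_leftP : h2; apply; split=> // k; by have /andP[] := r01 k.
- have cv : (N%:R * (1 - r k)) ^+ 2 * K @[k --> \oo] --> (0 : R).
    have c1 : N%:R * (1 - r k) @[k --> \oo] --> (0 : R).
      rewrite -(mulr0 N%:R) -(subrr (1 : R)).
      by apply: cvgM; [exact: cvg_cst|apply: cvgB => //; exact: cvg_cst].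
    rewrite -(mul0r K) -(mulr0 0); apply: cvgM; last exact: cvg_cst.
    by under eq_fun do rewrite expr2; exact: cvgM.
  move/cvgrPdist_lt : cv => /(_ _ (divr_gt0 e0 (ltr0n _ 2))); apply: filterS => k.
  rewrite sub0r normrN => h; apply: le_trans (EF _ (r01 k)) _; rewrite lee_fin.
  by have := ler_norm ((N%:R * (1 - r k)) ^+ 2 * K); move: h; lra.
Qed.

(** Taylor polynomials are orthogonal to characters of negative frequency, and [cintegralM_eq0]
    carries this over to their L^2 limit [f]. *)
Lemma fourier_H2plus f (k : int) : H2plus f -> k < 0 -> fourier f k = 0.
Proof.
move=> hf k0; have [lf _] := hf.
transitivity (cintegral (fun t => cexp (- k) t * f t)).
  by congr cintegral; apply/funext => t; rewrite -cexpN mulrC.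
apply: cintegralM_eq0 => // [|e e0]; first exact: L2_cexp.
(* The approximation gives a weak inequality where a strict one is wanted, hence [e / 2]. *)
have [N [c h]] := H2plus_approx hf (divr_gt0 e0 (ltr0n _ 2)).
exists (fun t => \sum_(i < N) c i * cexp i t); split.
- by apply: L2_sum => i; exact/L2Z/L2_cexp.
- apply: (@le_lt_trans _ _ (e / 2)); last lra.
  by rewrite -lee_fin fineK// ge0_fin_numE ?energy_ge0// (le_lt_trans h) ?ltry.
- transitivity (inner (fun t => \sum_(i < N) c i * cexp i t) (cexp k)).
    by congr cintegral; apply/funext => t; rewrite -cexpN mulrC.
  rewrite inner_suml => [|j|]; [|exact: L2_cexp|exact: L2_cexp].
  rewrite big1// => i _; rewrite inner_cexp; case: eqP => [E|_]; last by rewrite mulr0.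
  by move: k0; rewrite -E.
Qed.

Lemma fourier_H2minus f (k : int) : H2minus f -> 0 <= k -> fourier f k = 0.
Proof. by move=> [_ h]; case: k => // k _; apply: h; exact: H2plus_cexp. Qed.

Lemma H2minus_cexp (k : int) : k < 0 -> H2minus (cexp k : circle_fun R).
Proof.
move=> k0; split; first exact: L2_cexp.
move=> h hh; have [lh _] := hh; rewrite innerC//; last exact: L2_cexp.
by rewrite -/(fourier h k) fourier_H2plus// rmorph0.
Qed.

End Hardy.

(** * Kernels of paired operators and of their adjoints *)

Section PairedOperators.
Context {R : realType}.
Implicit Types (a b f g h p q : circle_fun R) (M : set (circle_fun R)).
Local Notation mu := (@arclength R).

Lemma inner0r f : inner f (cst 0) = 0.
Proof.
by rewrite /inner; under eq_fun do rewrite /= rmorph0 mulr0; exact: cintegral0.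
Qed.

Lemma inner_ae0l f g : L2 f -> L2 g -> ae_eq_circle f (cst 0) -> inner f g = 0.
Proof.
move=> lf lg f0; rewrite /inner -[RHS](@cintegral0 R); apply: ae_eq_cintegral.
- exact/cintegrable_cmeasurable/cintegrable_inner.
- exact: cmeasurable_cst.
- by apply: filterS f0 => t /= ->; rewrite mul0r.
Qed.

Lemma inner_ae0r f g : L2 f -> L2 g -> ae_eq_circle g (cst 0) -> inner f g = 0.
Proof. by move=> lf lg g0; rewrite innerC// inner_ae0l// rmorph0. Qed.

Lemma H2plus_L2 f : H2plus f -> L2 f. Proof. by case. Qed.

Lemma H2minus_L2 f : H2minus f -> L2 f. Proof. by case. Qed.

Lemma L2perp_ae0 M f : M `<=` L2 -> L2 f -> ae_eq_circle f (cst 0) -> L2perp M f.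
Proof. by move=> ML lf f0; split => // h /ML lh; exact: inner_ae0l. Qed.

Lemma L2perpB M f g : M `<=` L2 -> L2perp M f -> L2perp M g ->
  L2perp M (fun t => f t - g t).
Proof.
move=> ML [lf pf] [lg pg]; split; first exact: L2B.
by move=> h Mh; rewrite innerBl ?pf ?pg ?subrr//; exact: ML.
Qed.

Lemma H2plus0 : H2plus (cst 0 : circle_fun R).
Proof.
split; first exact: L2_cst; exists (cst 0).
- exists (fun=> 0).
    apply/cvg_ex; exists 0; apply: cvg_near_cst; apply: nearW => n.
    by rewrite /series /= big1// => i _; rewrite expr0n addr0 sqrtr0 expr0n.
  move=> z _; apply: cvg_near_cst; apply: nearW => n.
  by rewrite /series /= big1// => i _; rewrite mul0r.
- by apply: aeW => t; exact: cvg_cst.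
Qed.

Lemma H2minus0 : H2minus (cst 0 : circle_fun R).
Proof.
apply: L2perp_ae0; [exact: H2plus_L2|exact: L2_cst|exact: aeW].
Qed.

Lemma H2plus_perp p : H2plus p -> L2perp H2minus p.
Proof.
move=> hp; split; first exact: H2plus_L2.
move=> h [lh hh]; rewrite innerC ?hh ?rmorph0//; exact: H2plus_L2.
Qed.

(** The remainder [f - p - q] lies in [H2minus] and is orthogonal to [H2minus], hence orthogonal to
    itself. *)
Lemma orth_proj_sum f p q : orth_proj H2plus f p -> orth_proj H2minus f q ->
  ae_eq_circle f (fun t => p t + q t).
Proof.
move=> [hp fp] [hq fq].
have g1 : H2minus (fun t => f t - p t - q t) by exact: L2perpB H2plus_L2 fp hq.
have lg := H2minus_L2 g1.
suff : ae_eq_circle (fun t => f t - p t - q t) (cst 0).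
  by apply: filterS => t /= /eqP; rewrite -addrA -opprD subr_eq0 => /eqP.
apply: energy_eq0 => //.
rewrite [X in inner X _](_ : _ = (fun t => (f t - q t) - p t)); last first.
  by apply/funext => t; rewrite addrAC.
rewrite innerBl//; [|by case: fq|exact: H2plus_L2].
by case: fq => _ ->//; case: (H2plus_perp hp) => _ ->//; rewrite subrr.
Qed.

Lemma null_space_ker_paired_op a b : null_space `<=` ker (paired_op a b).
Proof.
move=> f [lf f0]; split; first exact: L2_cst.
have f0' : ae_eq_circle (fun t => f t - cst 0 t) (cst 0).
  by apply: filterS f0 => t /= ->; rewrite subrr.
have lf' : L2 (fun t => f t - cst 0 t) by apply: L2B => //; exact: L2_cst.
exists (cst 0), (cst 0); split.
- by split; [exact: H2plus0|exact: L2perp_ae0 H2plus_L2 _ _].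
- by split; [exact: H2minus0|exact: L2perp_ae0 H2minus_L2 _ _].
- by apply: aeW => t; rewrite /= !mulr0 addr0.
Qed.

(** If [p] vanished, [b * q = 0] with [b] nonzero would give [q = 0], and then [f = p + q] would
    vanish too. *)
Lemma ker_paired_op_neq a b : {ae mu, forall t, b t <> 0} ->
  ker (paired_op a b) <> null_space -> exists p q,
  [/\ H2plus p, H2minus q, ae_eq_circle (fun t => a t * p t + b t * q t) (cst 0) &
      ~ ae_eq_circle p (cst 0)].
Proof.
move=> b0 neq; apply: contrapT => N; apply: neq; apply/seteqP; split; last first.
  exact: null_space_ker_paired_op.
move=> f [_ [p [q [fp fq E]]]].
have [hp [lfp _]] := fp; have [hq _] := fq; have lp := H2plus_L2 hp.
have lf : L2 f by have := L2D lfp lp; under eq_fun do rewrite subrK.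
split => //; have [p0|p0] := pselect (ae_eq_circle p (cst 0)); last first.
  case: N; exists p, q; split => //.
  by apply: filterS E => t /= <-.
have S := orth_proj_sum fp fq.
have H : {ae mu, forall t, p t = 0 /\ q t = 0}.
  apply: filterS3 b0 p0 E => t /= bt pt.
  rewrite pt mulr0 add0r => /esym/eqP; rewrite mulf_eq0 => /orP[/eqP//|/eqP qt].
  by split.
by apply: filterS2 H S => t [pt qt] /= ->; rewrite pt qt; rewrite addr0.
Qed.

Lemma null_space_ker_adjoint a b : null_space `<=` ker (adjoint (paired_op a b)).
Proof.
move=> f [lf f0]; split => //; first exact: L2_cst.
by move=> h k [lk _]; rewrite inner0r inner_ae0r.
Qed.

(** The adjoint relation is tested on the characters: [cexp n] is sent to [a * cexp n] for [n >= 0]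
    and to [b * cexp n] for [n < 0]. *)
Lemma ker_adjoint_neq a b : Linfty a -> Linfty b ->
  ker (adjoint (paired_op a b)) <> null_space -> exists g,
  [/\ L2 g, forall n : int, 0 <= n -> inner (fun t => a t * cexp n t) g = 0,
      forall n : int, n < 0 -> inner (fun t => b t * cexp n t) g = 0 &
      ~ ae_eq_circle g (cst 0)].
Proof.
move=> ia ib neq; apply: contrapT => N; apply: neq; apply/seteqP; split; last first.
  exact: null_space_ker_adjoint.
move=> g [lg _ H]; split => //; apply: contrapT => g0; apply: N; exists g.
have perp0 M f : M `<=` L2 -> L2 f -> L2perp M (fun t => f t - f t).
  move=> ML lf; apply: L2perp_ae0 => //; first exact: L2B.
  by apply: aeW => t; exact: subrr.
split => // n n0.
- rewrite -(inner0r (cexp n)); apply: H; split.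
    exact/Linfty_L2/L2_cexp.
  have hn : H2plus (cexp n : circle_fun R) by case: n n0 => // n _; exact: H2plus_cexp.
  exists (cexp n), (cst 0); split.
  + by split => //; exact: perp0 H2plus_L2 (L2_cexp n).
  + split; first exact: H2minus0.
    have := H2plus_perp hn; congr (L2perp _ _).
    by apply/funext => t; rewrite subr0.
  + by apply: aeW => t; rewrite /= mulr0 addr0.
- rewrite -(inner0r (cexp n)); apply: H; split.
    exact/Linfty_L2/L2_cexp.
  have hn : H2minus (cexp n : circle_fun R) by exact: H2minus_cexp.
  exists (cst 0), (cexp n); split.
  + split; first exact: H2plus0.
    move: (hn); congr (L2perp _ _).
    by apply/funext => t; rewrite subr0.
  + by split => //; exact: perp0 H2minus_L2 (L2_cexp n).
  + by apply: aeW => t; rewrite /= mulr0 add0r.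
Qed.

Lemma ker_paired_op_or_swap a b : symbol_pair a b ->
  ker (paired_op a b) = null_space \/ ker (paired_op b a) = null_space.
Proof.
move=> [_ _ a0 b0 _].
have [|/(ker_paired_op_neq b0)[p [q [hp hq E p0]]]] :=
  pselect (ker (paired_op a b) = null_space); first by left.
have [|/(ker_paired_op_neq a0)[p' [q' [hp' hq' E' p0']]]] :=
  pselect (ker (paired_op b a) = null_space); first by right.
exfalso; case: (@analytic_product _ p' p q' q); [exact: H2plus_L2|
  exact: H2plus_L2|exact: H2minus_L2|exact: H2minus_L2|..|exact: p0'|exact: p0].
- by move=> n; exact: fourier_H2plus.
- by move=> n; exact: fourier_H2plus.
- by move=> n n0; apply: fourier_H2minus => //; exact: ltW.
- by move=> n; exact: fourier_H2minus.
(* The product of the two kernel relations reads [a b p' p = a b q' q], and [a b] cancels almost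
   everywhere. *)
have ab0 : {ae mu, forall t, a t * b t <> 0}.
  by apply: filterS2 a0 b0 => t /eqP at0 /eqP bt0; apply/eqP; rewrite mulf_neq0.
apply: filterS3 ab0 E E' => t /= abt Et Et'.
apply: (mulfI (x := a t * b t)); first exact/eqP.
have -> : a t * b t * (p' t * p t) = (a t * p t) * (b t * p' t) by ring.
have -> : a t * p t = - (b t * q t) by apply/eqP; rewrite -addr_eq0 Et.
have -> : b t * p' t = - (a t * q' t) by apply/eqP; rewrite -addr_eq0 Et'.
ring.
Qed.

Lemma ker_paired_op_or_adjoint a b : symbol_pair a b ->
  ker (paired_op a b) = null_space \/ ker (adjoint (paired_op a b)) = null_space.
Proof.
move=> [ia ib a0 b0 _].
have [|/(ker_paired_op_neq b0)[p [q [hp hq E p0]]]] :=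
  pselect (ker (paired_op a b) = null_space); first by left.
have [|/(ker_adjoint_neq ia ib)[g [lg ga gb g0]]] :=
  pselect (ker (adjoint (paired_op a b)) = null_space); first by right.
exfalso.
have lgc := L2_conj lg.
(* Conjugating [g] reverses frequencies: [ga] annihilates the coefficients of [a * conj g] at
   [n <= 0], and [gb] those of [b * conj g] at [n > 0]. *)
have F (c : circle_fun R) (n : int) :
    fourier (fun t => c t * (g t)^*) n = inner (fun t => c t * cexp (- n) t) g.
  by congr cintegral; apply/funext => t; rewrite -cexpN mulrAC.
(* The identity used is [a p = - b q] times [conj g], with the sign absorbed into [v]. *)
case: (@analytic_product _ (fun t => a t * (g t)^*) p (fun t => (- b t) * (g t)^*) q).
- exact: Linfty_L2.
- exact: H2plus_L2.
- by have := L2Z (-1) (Linfty_L2 ib lgc); under eq_fun do rewrite mulN1r -mulNr.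
- exact: H2minus_L2.
- by move=> n n0; rewrite F ga// oppr_ge0 ltW.
- by move=> n; exact: fourier_H2plus.
- move=> n n0; rewrite F.
  transitivity (- 1 * inner (fun t => b t * cexp (- n) t) g); last first.
    by rewrite gb ?mulr0// oppr_lt0.
  rewrite /inner -cintegralZ; last by apply: cintegrable_inner => //; exact/Linfty_L2/L2_cexp.
  by congr cintegral; apply/funext => t; ring.
- by move=> n; exact: fourier_H2minus.
- apply: filterS E => t /= Et.
  have -> : a t * (g t)^* * p t = (g t)^* * (a t * p t) by ring.
  have -> : a t * p t = - (b t * q t) by apply/eqP; rewrite -addr_eq0 Et.
  ring.
(* As [a] is nonzero almost everywhere, [a * conj g = 0] would force [g = 0]. *)
- move=> u0; apply: g0; apply: filterS2 a0 u0 => t /= at0 /eqP.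
  by rewrite mulf_eq0 conjC_eq0 => /orP[/eqP//|/eqP].
- exact: p0.
Qed.

End PairedOperators.

Theorem theorem3p8 (R : realType) (a b : circle_fun R)
    (hab : symbol_pair a b) :
  (ker (paired_op a b) = null_space \/ ker (paired_op b a) = null_space) /\
  ((exists a' b' : circle_fun R, [/\ Linfty a', Linfty b' &
      ae_eq_circle (fun t => a t * a' t + b t * b' t) (cst 1)]) ->
   ker (paired_op a b) = null_space \/
   ker (adjoint (paired_op a b)) = null_space).
Proof.
split; first exact: ker_paired_op_or_swap.
by move=> _; exact: ker_paired_op_or_adjoint.
Qed.
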